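(* Let $(\mathcal{M},g)$ be a smooth Riemannian manifold. Then there exist $n\in\mathbb{N}$ and families of probability density functions $P_1,\dots,P_n$, each with a one-dimensional spatial domain $X_i\subset\mathbb{R}$ and all parametrised by $\mathcal{M}$, such that the Fisher information metric of the spatially disjoint product $P=\bigodot_{i=1}^n P_i$ is $g$; that is, in every local coordinate system $\theta=(\theta^1,\dots,\theta^m)$ on $\mathcal{M}$, $g_{ab}(P)(\theta)=g_{ab}(\theta)$ for all $a,b$.
   Context: A family of probability density functions with spatial domain $X\subset\mathbb{R}^k$ (a nonempty connected open set) parametrised by a manifold $\mathcal{M}$ is a function $P:X\times\mathcal{M}\to\mathbb{R}$, $P\ge 0$, such that for each $\theta\in\mathcal{M}$ the function $P(\cdot;\theta)$ is continuous on $X$, $\int_X P(x;\theta)\,\mathrm{d}x=1$, and in local coordinates on $\mathcal{M}$ the derivatives $\partial_a P=\partial P/\partial\theta^a$ exist and are continuous on $X$. The Fisher information metric of $P$ has components, in local coordinates $\theta^a$ on $\mathcal{M}$, $$g_{ab}(P)(\theta)=\int_X P(x;\theta)\,\partial_a\ln P(x;\theta)\,\partial_b\ln P(x;\theta)\,\mathrm{d}x$$ (integrand taken to be $0$ where $P=0$). The spatially disjoint product of families $P_i:X_i\times\mathcal{M}\to\mathbb{R}$ with $X_i\subset\mathbb{R}$, $i=1,\dots,n$, is the family on $X_1\times\cdots\times X_n$ given by $$\Big(\bigodot_{i=1}^nP_i\Big)(x^1,\dots,x^n;\theta)=\prod_{i=1}^nP_i(x^i;\theta).$$ *)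

(* Defs.v *)
From HB Require Import structures.
From mathcomp Require Import all_boot all_order all_algebra.
From mathcomp Require Import all_classical all_reals all_analysis.

Set Implicit Arguments.
Unset Strict Implicit.
Unset Printing Implicit Defensive.

Import Order.TTheory GRing.Theory Num.Theory.
Import numFieldNormedType.Exports.

Local Open Scope classical_set_scope.
Local Open Scope ring_scope.

(* Lebesgue measure on R^n, as the n-fold product of the Lebesgue measure on   *)
(* R: the n.+1-dimensional one is the image of the product measure on R * R^n  *)
(* under (x, t) |-> x :: t (see lebesgue_tuple_box).                           *)
Section lebesgue_tuple_step.
Variables (R : realType) (n : nat).
Local Notation T := (measurableTypeR R).
Variable mu : {sigma_finite_measure set (n.-tuple T) -> \bar R}.

Definition tuple_cons (x : T * n.-tuple T) : n.+1.-tuple T :=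
  [tuple of x.1 :: x.2].

Lemma measurable_tuple_cons : measurable_fun [set: T * n.-tuple T] tuple_cons.
Proof. exact: measurable_cons. Qed.

Definition lebesgue_tuple_succ : set (n.+1.-tuple T) -> \bar R :=
  pushforward (lebesgue_measure \x mu)%E tuple_cons.

Let lebS0 : lebesgue_tuple_succ set0 = 0%E.
Proof. exact: (measure0 (lebesgue_measure \x mu)%E). Qed.

Let lebS_ge0 A : (0 <= lebesgue_tuple_succ A)%E.
Proof. exact: (measure_ge0 (lebesgue_measure \x mu)%E). Qed.

Let lebS_sigma_additive : semi_sigma_additive lebesgue_tuple_succ.
Proof.
pose nu : {measure set (T * n.-tuple T) -> \bar R} := (lebesgue_measure \x mu)%E.
pose c := tuple_cons; have mc : measurable_fun [set: T * n.-tuple T] c.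
  exact: measurable_tuple_cons.
move=> F mF tF mUF; rewrite /lebesgue_tuple_succ /pushforward preimage_bigcup.
apply: (measure_semi_sigma_additive (s := nu)).
- by move=> k; rewrite -[X in measurable X]setTI; exact: mc.
- apply/trivIsetP => /= i j _ _ ij; rewrite -preimage_setI.
  by move/trivIsetP : tF => /(_ _ _ _ _ ij) ->//; rewrite preimage_set0.
- by rewrite -preimage_bigcup -[X in measurable X]setTI; exact: mc.
Qed.

HB.instance Definition _ := isMeasure.Build _ _ _ lebesgue_tuple_succ
  lebS0 lebS_ge0 lebS_sigma_additive.

Lemma lebesgue_tuple_succX (A : set T) (B : set (n.-tuple T)) :
  measurable A -> measurable B ->
  lebesgue_tuple_succ [set t | A (thead t) /\ B [tuple of behead t]] =
  (lebesgue_measure A * mu B)%E.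
Proof.
move=> mA mB; rewrite -product_measure1E//.
rewrite /lebesgue_tuple_succ /pushforward; apply: congr1.
apply/seteqP; split => -[x t] /=; rewrite /tuple_cons /= theadE;
  (have -> : [tuple of behead [tuple of x :: t]] = t by exact: val_inj); by case.
Qed.

Lemma measurable_tupleX (A : set T) (B : set (n.-tuple T)) :
  measurable A -> measurable B ->
  measurable [set t : n.+1.-tuple T | A (thead t) /\ B [tuple of behead t]].
Proof.
move=> mA mB.
have m1 := measurable_tnth (T := T) (@ord0 n) measurableT mA.
have m2 := measurable_behead (T := T) measurableT mB.
by rewrite !setTI in m1 m2; exact: measurableI m1 m2.
Qed.

Let lebS_sigma_finite : sigma_finite setT lebesgue_tuple_succ.
Proof.
have /sigma_finiteP[F [TF ndF Foo]] :=
  sigma_finiteT (@lebesgue_measure R).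
have /sigma_finiteP[G [TG ndG Goo]] := sigma_finiteT mu.
exists (fun k => [set t | F k (thead t) /\ G k [tuple of behead t]]).
  apply/seteqP; split => // t _.
  have : setT (thead t) by []. rewrite TF => -[i _ Fi].
  have : setT [tuple of behead t] by []. rewrite TG => -[j _ Gj].
  exists (maxn i j) => //=; split.
    by move: Fi; apply/subsetPset/ndF/leq_maxl.
  by move: Gj; apply/subsetPset/ndG/leq_maxr.
move=> k; have [mF oF] := Foo k; have [mG oG] := Goo k.
split; first exact: measurable_tupleX.
by rewrite lebesgue_tuple_succX// lte_mul_pinfty// ge0_fin_numE.
Qed.

HB.instance Definition _ := Measure_isSigmaFinite.Build _ _ _
  lebesgue_tuple_succ lebS_sigma_finite.

End lebesgue_tuple_step.

Fixpoint lebesgue_tuple (R : realType) (n : nat) :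
    {sigma_finite_measure set (n.-tuple (measurableTypeR R)) -> \bar R} :=
  match n with
  | 0 => \d_([tuple] : 0.-tuple (measurableTypeR R))
  | n'.+1 => lebesgue_tuple_succ (lebesgue_tuple R n')
  end.

Lemma measurable_tuple_box (R : realType) (n : nat)
    (A : 'I_n -> set (measurableTypeR R)) :
  (forall i, measurable (A i)) ->
  measurable [set t : n.-tuple (measurableTypeR R) | forall i, A i (tnth t i)].
Proof.
move=> mA; rewrite (_ : mkset _ = \bigcap_(i : 'I_n) ((@tnth n _)^~ i @^-1` A i)).
  apply: fin_bigcap_measurable => // i _.
  by rewrite -[X in measurable X]setTI; exact: measurable_tnth.
by apply/seteqP; split => t /= At i; [move=> _; exact: At|exact: (At i I)].
Qed.

Lemma lebesgue_tuple_box (R : realType) (n : nat)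
    (A : 'I_n -> set (measurableTypeR R)) :
  (forall i, measurable (A i)) ->
  lebesgue_tuple R n [set t | forall i, A i (tnth t i)] =
  (\prod_(i < n) lebesgue_measure (A i))%E.
Proof.
elim: n A => [|n IH] A mA.
  rewrite big_ord0 /= diracE mem_set//= => -[]//.
rewrite big_ord_recl -IH; last by move=> i; exact: mA.
have mB : measurable [set t : n.-tuple (measurableTypeR R) |
    forall i, A (lift ord0 i) (tnth t i)].
  by apply: (measurable_tuple_box (A := fun i => A (lift ord0 i))) => i.
rewrite -lebesgue_tuple_succX//=; apply: congr1.
apply/seteqP; split => t /=.
  move=> At; split; first exact: At.
  by move=> i; have := At (lift ord0 i); rewrite [in X in X -> _](tuple_eta t) tnthS.
move=> [A0 At] i; have [j ->|->//] := unliftP ord0 i.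
by rewrite (tuple_eta t) tnthS; exact: At.
Qed.

Definition basis_vec (R : realType) (m : nat) (a : 'I_m) : 'rV[R]_m :=
  delta_mx ord0 a.

Fixpoint class_C (R : realType) (m k : nat) (U : set 'rV[R]_m)
    (f : 'rV[R]_m -> R) : Prop :=
  match k with
  | 0 => {within U, continuous f}
  | k'.+1 => forall a : 'I_m,
      (forall x, U x -> derivable f x (basis_vec R a)) /\
      class_C k' U ('D_(basis_vec R a) f)
  end.

Definition smooth_on (R : realType) (m : nat) (U : set 'rV[R]_m)
    (f : 'rV[R]_m -> R) : Prop :=
  forall k, class_C k U f.

(* The values of chart_map outside chart_dom, and of chart_inv outside the     *)
(* image of chart_dom, are irrelevant.                                         *)
Record chart (R : realType) (M : topologicalType) (m : nat) := Chart {
  chart_dom : set M;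
  chart_map :> M -> 'rV[R]_m;
  chart_inv : 'rV[R]_m -> M;
  chart_dom_open : open chart_dom;
  chart_img_open : open (chart_map @` chart_dom);
  chart_mapK : forall p, chart_dom p -> chart_inv (chart_map p) = p;
  chart_map_continuous : {within chart_dom, continuous chart_map};
  chart_inv_continuous :
    {within chart_map @` chart_dom, continuous chart_inv} }.

Section charts.
Variables (R : realType) (M : topologicalType) (m : nat).
Implicit Types (c : chart R M m) (F : M -> R) (p : M) (a i : 'I_m).

Definition chart_img c : set 'rV[R]_m := c @` chart_dom c.

Definition coord c i p : R := c p ord0 i.

Definition pderivable c a F p : Prop :=
  derivable (F \o chart_inv c) (c p) (basis_vec R a).

Definition pderive c a F p : R :=
  'D_(basis_vec R a) (F \o chart_inv c) (c p).

Definition smooth_transition c c' : Prop :=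
  forall i, smooth_on (c @` (chart_dom c `&` chart_dom c'))
                      (coord c' i \o chart_inv c).

Definition compatible c c' : Prop :=
  smooth_transition c c' /\ smooth_transition c' c.

End charts.

Record smooth_manifold (R : realType) (m : nat) := SmoothManifold {
  manifold_space :> topologicalType;
  manifold_hausdorff : hausdorff_space manifold_space;
  manifold_second_countable : @second_countable manifold_space;
  atlas : set (chart R manifold_space m);
  atlas_cover : forall p, exists2 c, atlas c & chart_dom c p;
  atlas_compatible : forall c c', atlas c -> atlas c' -> compatible c c' }.

(* The local coordinate systems on M are the charts of the maximal atlas.      *)
Definition local_coordinates (R : realType) (m : nat) (M : smooth_manifold R m)
    (c : chart R M m) : Prop :=
  forall c', atlas c' -> compatible c c'.

(* A Riemannian metric, given as a tensor field by its matrix of components in *)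
(* each local coordinate system; only metric_comp c p with c a local           *)
(* coordinate system and p in its domain is meaningful.                        *)
Record riemannian_metric (R : realType) (m : nat) (M : smooth_manifold R m) :=
    RiemannianMetric {
  metric_comp :> chart R M m -> M -> 'M[R]_m;
  metric_smooth : forall c, local_coordinates c ->
    forall a b, smooth_on (chart_img c) (fun x => metric_comp c (chart_inv c x) a b);
  metric_sym : forall c p, local_coordinates c -> chart_dom c p ->
    (metric_comp c p)^T = metric_comp c p;
  metric_posdef : forall c p, local_coordinates c -> chart_dom c p ->
    forall v : 'rV[R]_m, v != 0 ->
      0 < \sum_(a < m) \sum_(b < m) metric_comp c p a b * v ord0 a * v ord0 b;
  metric_tensorial : forall c c' p,
    local_coordinates c -> local_coordinates c' ->
    chart_dom c p -> chart_dom c' p ->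
    forall a b, metric_comp c p a b =
      \sum_(i < m) \sum_(j < m) metric_comp c' p i j *
        pderive c a (coord c' i) p * pderive c b (coord c' j) p }.

Definition spatial_domain (R : realType) (X : set R) : Prop :=
  [/\ X !=set0, open X & connected X].

Section pdf_families.
Variables (R : realType) (m : nat) (M : smooth_manifold R m).

Record pdf_family (X : set R) (P : R -> M -> R) : Prop := PdfFamily {
  pdf_domain : spatial_domain X;
  pdf_ge0 : forall x p, X x -> 0 <= P x p;
  pdf_continuous : forall p, {within X, continuous (fun x => P x p)};
  pdf_integral1 : forall p,
    (\int[@lebesgue_measure R]_(x in X) (P x p)%:E = 1)%E;
  pdf_pderivable : forall c p, local_coordinates c -> chart_dom c p ->
    forall a x, X x -> pderivable c a (P x) p;
  pdf_pderive_continuous : forall c p, local_coordinates c -> chart_dom c p ->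
    forall a, {within X, continuous (fun x => pderive c a (P x) p)} }.

(* Component (a, b), in the coordinates c at p, of the Fisher information of a *)
(* density P on the subset X of R^n. The integrand is 0 where P is, ln being a *)
(* total function. The value is an extended real number: it is finite only if  *)
(* the integrals of the positive and negative parts both are.                  *)
Definition fisher_information (n : nat) (X : set (n.-tuple (measurableTypeR R)))
    (P : n.-tuple (measurableTypeR R) -> M -> R) (c : chart R M m) (p : M)
    (a b : 'I_m) : \bar R :=
  (\int[lebesgue_tuple R n]_(x in X)
    (P x p * pderive c a (fun q => ln (P x q)) p
           * pderive c b (fun q => ln (P x q)) p)%:E)%E.

Definition disjoint_product_domain (n : nat) (X : 'I_n -> set R) :
    set (n.-tuple (measurableTypeR R)) :=
  [set x | forall i, X i (tnth x i)].

Definition disjoint_product (n : nat) (P : 'I_n -> R -> M -> R)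
    (x : n.-tuple (measurableTypeR R)) (p : M) : R :=
  \prod_(i < n) P i (tnth x i) p.

End pdf_families.

(* Main.v *)
Require Import Defs.
From HB Require Import structures.
From mathcomp Require Import all_boot all_order all_algebra.
From mathcomp Require Import all_classical all_reals all_analysis.
From mathcomp Require Import finmap measurable_realfun ring lra zify.

Set Implicit Arguments.
Unset Strict Implicit.
Unset Printing Implicit Defensive.

Import Order.TTheory GRing.Theory Num.Theory.
Import numFieldNormedType.Exports.

Local Open Scope classical_set_scope.
Local Open Scope ring_scope.

(* A single family on the line suffices, so Nash's embedding theorem can be
   replaced by a C^1 isometric embedding of M into l^2: if
   g = sum_k (df_k)^2, put on the cell ]k, k+1[ a density of mass 2^-(k+1) whose
   square root moves on a circle of L^2(]k, k+1[), with angle proportional to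
   f_k(theta). Its Fisher information is (df_k)^2, and the information of
   densities with disjoint supports adds up.

   The f_k are found greedily. Given f_1, ..., f_N with h = g - sum (df_i)^2
   positive definite, and a compact set K inside a chart, finitely many further
   functions remove from h a quantity below h everywhere and above d h on K,
   where d > 0 is a universal constant. For this, cover K by small cells on which
   h is nearly a constant form, write that form as a sum of squares of linear
   forms w, and use a cos(l w)/l and a sin(l w)/l with a bump amplitude a and a
   large frequency l. Running through countably many such K covering M, each one
   infinitely often, the remainder h tends to 0 pointwise. Only the continuity of
   h is used, hence C^1 functions are enough and no derivative is lost. *)

(** * Quadratic forms *)

Section quadratic_forms.
Variables (R : realType) (m : nat).
Implicit Types (A B : 'M[R]_m) (u v w : 'rV[R]_m).

Definition dotv u v : R := \sum_(a < m) u ord0 a * v ord0 a.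

Definition bform A u v : R :=
  \sum_(a < m) \sum_(b < m) A a b * u ord0 a * v ord0 b.

Definition qform A v : R := bform A v v.

Lemma bformE A u v : bform A u v = (u *m A *m v^T) ord0 ord0.
Proof.
rewrite mxE /bform exchange_big; apply: eq_bigr => b _.
rewrite !mxE mulr_suml; apply: eq_bigr => a _.
by rewrite [A a b * _]mulrC.
Qed.

Lemma dotvE u v : dotv u v = (u *m v^T) ord0 ord0.
Proof. by rewrite mxE; apply: eq_bigr => a _; rewrite mxE. Qed.

Lemma bform_sym A u v : A^T = A -> bform A u v = bform A v u.
Proof.
move=> sA; rewrite !bformE -[in LHS](trmxK (u *m A *m v^T)) mxE.
by rewrite !trmx_mul trmxK sA mulmxA.
Qed.

Lemma qformD A t u v : A^T = A ->
  qform A (u + t *: v) = qform A u + t * bform A u v *+ 2 + t ^+ 2 * qform A v.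
Proof.
move=> sA; rewrite /qform mulr2n -{2}(bform_sym _ _ sA) !bformE.
rewrite [(u + t *: v)^T]raddfD /= !mulmxDl !mulmxDr linearZ /=.
rewrite -!scalemxAl -!scalemxAr !mxE; ring.
Qed.

Definition psd A := A^T = A /\ forall v, 0 <= qform A v.

(** The polynomial t -> [qform A (u + t *: v)] is nonnegative. It is evaluated at its minimum, or,
    if [qform A v] is 0 and it is affine, far out. *)
Lemma psd_CauchySchwarz A u v : psd A ->
  bform A u v ^+ 2 <= qform A u * qform A v.
Proof.
move=> [sA pA]; have key t := pA (u + t *: v).
have [v0|v0] := eqVneq (qform A v) 0.
  have [->|b0] := eqVneq (bform A u v) 0.
    by rewrite expr0n /= mulr_ge0.
  (* At this t the affine polynomial equals -3 [qform A u] - 4, which is negative. *)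
  have := key (- (qform A u + 1) / bform A u v *+ 2).
  rewrite qformD// v0 mulr0 addr0 mulrnAl divfK//.
  by have := pA u; lra.
have v1 : 0 < qform A v by rewrite lt_neqAle eq_sym v0 pA.
have := key (- bform A u v / qform A v); rewrite qformD//.
rewrite -(ler_pM2r v1) mul0r => h; rewrite -subr_ge0; apply: le_trans h _.
rewrite le_eqVlt; apply/orP; left; apply/eqP; field.
by rewrite v0.
Qed.

Lemma qformB A B v : qform (A - B) v = qform A v - qform B v.
Proof. by rewrite /qform !bformE mulmxBr mulmxBl !mxE. Qed.

Lemma qform_dotv c w v :
  qform (c *: (w^T *m w)) v = c * dotv w v ^+ 2.
Proof.
rewrite /qform bformE dotvE -scalemxAr -scalemxAl mxE; congr (_ * _).
rewrite mulmxA -[_ *m w *m _]mulmxA mxE big_ord1 expr2; congr (_ * _).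
by rewrite -[in RHS](trmxK (w *m v^T)) [RHS]mxE trmx_mul trmxK.
Qed.

Lemma bform_delta A i v : bform A (delta_mx ord0 i) v = dotv (row i A) v.
Proof. by rewrite bformE dotvE -rowE. Qed.

Lemma qform_delta A i : qform A (delta_mx ord0 i) = A i i.
Proof.
rewrite /qform bform_delta /dotv (bigD1 i)//= big1 ?addr0 ?mxE ?eqxx ?mulr1//.
by move=> j ji; rewrite !mxE (negPf ji) andbF mulr0.
Qed.

Lemma bform_delta2 A i j : bform A (delta_mx ord0 i) (delta_mx ord0 j) = A i j.
Proof.
rewrite bform_delta /dotv (bigD1 j)//= big1 ?addr0 ?mxE ?eqxx ?mulr1//.
by move=> k ji; rewrite !mxE (negPf ji) andbF mulr0.
Qed.

(** A step of symmetric Gaussian elimination. Positivity survives by Cauchy-Schwarz against the i-th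
    basis vector. If [A i i] is 0, its inverse is 0 by convention and [A'] is [A]; Cauchy-Schwarz
    then says that row i was already zero. *)
Lemma psd_deflate A i : psd A ->
  let A' := A - (A i i)^-1 *: ((row i A)^T *m row i A) in
  [/\ psd A', row i A' = 0 & forall k, row k A = 0 -> row k A' = 0].
Proof.
move=> pA A'; have [sA A0] := pA.
have rk (k : 'I_m) : row k A' = row k A - (A i i)^-1 * A k i *: row i A.
  apply/rowP => j; rewrite !mxE big_ord1 !mxE.
  by rewrite -[in A i k]sA mxE mulrA.
split.
- split; first by rewrite /A' linearB linearZ /= trmx_mul trmxK sA.
  move=> v; rewrite qformB qform_dotv subr_ge0 -bform_delta.
  have := psd_CauchySchwarz (delta_mx ord0 i) v pA; rewrite qform_delta => h.
  have [->|Aii] := eqVneq (A i i) 0; first by rewrite invr0 mul0r.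
  have Aii0 : 0 < A i i by rewrite lt_neqAle eq_sym Aii -qform_delta A0.
  by rewrite mulrC ler_pdivrMr// mulrC.
- rewrite rk; have [Aii|Aii] := eqVneq (A i i) 0; last first.
    by rewrite mulVf// scale1r subrr.
  rewrite Aii invr0 mul0r scale0r subr0; apply/rowP => j; rewrite !mxE.
  have := psd_CauchySchwarz (delta_mx ord0 i) (delta_mx ord0 j) pA.
  rewrite qform_delta Aii mul0r bform_delta2 => h; apply/eqP.
  by rewrite -sqrf_eq0 eq_le h sqr_ge0.
- move=> k k0; rewrite rk k0; have -> : A k i = row k A ord0 i by rewrite mxE.
  by rewrite k0 mxE mulr0 scale0r subr0.
Qed.

(** Deflating the rows one after the other splits off one square each time, and nothing is left
    after m steps. *)
Lemma psd_sum_squares A : psd A ->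
  exists w : 'I_m -> 'rV[R]_m, forall v, qform A v = \sum_j dotv (w j) v ^+ 2.
Proof.
move=> pA.
have [k]: exists k, k = m by exists m.
suff : forall k, (k <= m)%N -> exists (w : nat -> 'rV[R]_m) B,
    [/\ psd B, forall i : 'I_m, (i < k)%N -> row i B = 0 &
      forall v, qform A v = qform B v + \sum_(j < k) dotv (w j) v ^+ 2].
  move=> /(_ m (leqnn m))[w [B [_ B0 wE]]] _; exists (fun j => w j) => v.
  rewrite wE; suff -> : B = 0.
    by rewrite /qform bformE mulmx0 mul0mx mxE add0r.
  by apply/row_matrixP => i; rewrite B0// row0.
elim => [_|{}k IH km].
  by exists (fun=> 0), A; split => // v; rewrite big_ord0 addr0.
have [w [B [pB B0 wE]]] := IH (ltnW km).
pose i := Ordinal km; have [pB' Bi' Bk'] := psd_deflate i pB.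
(* If [B i i] is 0 this new vector is 0, in agreement with the trivial deflation. *)
exists (fun j => if j == k then (Num.sqrt (B i i))^-1 *: row i B else w j).
eexists; split; [exact: pB'| |].
  move=> j; rewrite ltnS leq_eqVlt => /orP[/eqP ji|jk].
    by rewrite (_ : j = i)//; exact: val_inj.
  by rewrite Bk'// B0.
move=> v; rewrite wE qformB big_ord_recr /= eqxx qform_dotv.
under [in RHS]eq_bigr do rewrite (ltn_eqF (ltn_ord _)).
set x := (X in _ = _ - X + _); set y := (X in _ = _ + (_ + X)).
suff -> : y = x by rewrite addrA addrAC subrK.
rewrite /x /y [dotv (_ *: _) _]dotvE -scalemxAl mxE -dotvE exprMn exprVn.
by rewrite sqr_sqrtr// -qform_delta; have [_] := pB; exact.
Qed.

Definition posdef A := A^T = A /\ forall v, v != 0 -> 0 < qform A v.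

Lemma posdef_psd A : posdef A -> psd A.
Proof.
move=> [sA pA]; split => // v; have [->|/pA/ltW//] := eqVneq v 0.
by rewrite /qform bformE mul0mx mul0mx mxE.
Qed.

Lemma posdef_coercive A : posdef A ->
  exists2 C, 0 <= C & forall v, \sum_a v ord0 a ^+ 2 <= C * qform A v.
Proof.
move=> pA; have psA := posdef_psd pA.
have uA : A \in unitmx.
  rewrite -row_free_unit -kermx_eq0; apply/rowV0P => v /sub_kermxP vA.
  apply/eqP/negPn/negP => v0; have := pA.2 _ v0.
  by rewrite /qform bformE vA mul0mx mxE ltxx.
(* The i-th coordinate of v is [bform A (row i (invmx A)) v], so Cauchy-Schwarz bounds its
   square. *)
exists (\sum_i qform A (row i (invmx A))).
  by apply: sumr_ge0 => i _; exact: psA.2.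
move=> v; rewrite mulr_suml; apply: ler_sum => i _.
apply: le_trans (psd_CauchySchwarz (row i (invmx A)) v psA).
rewrite bformE -row_mul mulVmx// row1 mxE.
rewrite (bigD1 i)//= big1 ?addr0 ?mxE ?eqxx ?mul1r//.
by move=> j ji; rewrite !mxE (negPf ji) andbF mul0r.
Qed.

(** An entrywise perturbation of size e changes the form by at most e m |v|^2, which coercivity
    bounds by half of [qform A v] when e is small. *)
Lemma posdef_near A : posdef A ->
  exists2 e : R, 0 < e & forall B, (forall a b, `|B a b - A a b| <= e) ->
    forall v, qform A v <= 2 * qform B v /\ qform B v <= 2 * qform A v.
Proof.
move=> pA; have psA := posdef_psd pA; have [C C0 AC] := posdef_coercive pA.
(* The added 1 keeps [K] positive when m or [C] is 0. *)
pose K := m%:R * C + 1; have K0 : 0 < K by rewrite ltr_wpDl// mulr_ge0.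
exists ((2 * K)^-1); first by rewrite invr_gt0 mulr_gt0.
move=> B BA v; suff : `|qform (B - A) v| <= qform A v / 2.
  rewrite qformB ler_norml => /andP[]; have := psA.2 v; lra.
have h1 : `|qform (B - A) v| <=
    \sum_a \sum_b (2 * K)^-1 * (v ord0 a ^+ 2 + v ord0 b ^+ 2) / 2.
  apply: le_trans (ler_norm_sum _ _ _) _; apply: ler_sum => a _.
  apply: le_trans (ler_norm_sum _ _ _) _; apply: ler_sum => b _.
  rewrite !normrM !mxE -mulrA -[leRHS]mulrA ler_pM//.
  rewrite -normrM ler_norml; have := sqr_ge0 (v ord0 a + v ord0 b).
  by have := sqr_ge0 (v ord0 a - v ord0 b); rewrite !expr2; lra.
apply: le_trans h1 _; set S := \sum_a v ord0 a ^+ 2.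
have -> : \sum_a \sum_b (2 * K)^-1 * (v ord0 a ^+ 2 + v ord0 b ^+ 2) / 2
    = (2 * K)^-1 * (m%:R * S).
  under eq_bigr do rewrite -mulr_suml -mulr_sumr big_split /= sumr_const.
  rewrite -mulr_suml -mulr_sumr big_split /= sumr_const card_ord.
  rewrite !sumrMnl -/S -(mulr_natl S); field.
  by rewrite gt_eqF.
have vC := AC v; rewrite mulrC ler_pdivrMr ?mulr_gt0//.
apply: le_trans (ler_wpM2l (ler0n _ m) vC) _; rewrite mulrA.
have -> : qform A v / 2 * (2 * K) = qform A v * K by field.
rewrite [leRHS]mulrC ler_wpM2r ?psA.2// /K; lra.
Qed.

End quadratic_forms.

(** * Functions of class C^1 on R^m *)

Lemma linear_approx_differentiable (R : realType) (V W : normedModType R)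
    (f : V -> W) (L : {linear V -> W}) (x : V) : continuous L ->
  (forall e, 0 < e ->
    \forall h \near 0, `|f (h + x) - f x - L h| <= e * `|h|) ->
  differentiable f x.
Proof.
move=> cL fx; have fL : f \o shift x = cst (f x) + L +o_ 0 id.
  apply/eqaddoP => e e0; have := fx _ e0; apply: filterS => h /=.
  by rewrite opprD addrA; exact.
have dL : 'd f x = L :> (_ -> _) by exact: diff_unique.
by apply/diff_locallyP; split; rewrite dL.
Qed.

Lemma cvg_sumr (R : numFieldType) (I T : Type) (F : set_system T)
    (r : seq I) (P : pred I) (f : I -> T -> R) (l : I -> R) : Filter F ->
  (forall i, P i -> f i x @[x --> F] --> l i) ->
  \sum_(i <- r | P i) f i x @[x --> F] --> \sum_(i <- r | P i) l i.
Proof. by move=> FF fl; apply: cvg_big => // [[x y]]; exact: add_continuous. Qed.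

(** * Continuous partial derivatives imply differentiability *)

Section partial_derivatives.
Variables (R : realType) (m : nat).
Implicit Types (f : 'rV[R]_m -> R) (x y v : 'rV[R]_m).

Lemma is_derive_line f y v t df : is_derive (t *: v + y) v f df ->
  is_derive t 1 (fun s : R => f (s *: v + y)) df.
Proof.
move=> [fd fE]; have E : (fun h : R => h^-1 *: (((fun s : R => f (s *: v + y))
    \o shift t) h%:A - f (t *: v + y))) =
    (fun h : R => h^-1 *: ((f \o shift (t *: v + y)) (h *: v) - f (t *: v + y))).
  by apply/funext => h /=; rewrite [h%:A]mulr1 scalerDl addrA.
by apply: DeriveDef; rewrite /derivable /derive E.
Qed.

(** The mean value theorem along a line, for either sign of h: the cost of moving one coordinate in
    [partial_differentiable]. *)
Lemma line_increment f y v c e h :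
  (forall t, `|t| <= `|h| ->
    derivable f (t *: v + y) v /\ `|'D_v f (t *: v + y) - c| <= e) ->
  `|f (h *: v + y) - f y - h * c| <= e * `|h|.
Proof.
move=> fh; pose g (s : R) := f (s *: v + y).
have dg (t : R) : `|t| <= `|h| -> is_derive t 1 g ('D_v f (t *: v + y)).
  by move=> /fh[fd _]; apply: is_derive_line; exact: derivableP.
have cg (a b : R) : (forall t : R, t \in `[a, b]%R -> `|t| <= `|h|) ->
    {within `[a, b], continuous g}.
  move=> ab; apply: derivable_within_continuous => t /ab/dg td.
  exact: ex_derive.
have -> : f y = g 0 by rewrite /g scale0r add0r.
rewrite -/(g h); have [h0|h0] := leP 0 h.
  have itv (t : R) : t \in `[0, h]%R -> `|t| <= `|h|.
    by rewrite in_itv /= => /andP[t0 th]; rewrite !ger0_norm.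
  have itvo (t : R) : t \in `]0, h[%R -> t \in `[0, h]%R by exact: subset_itvW.
  have [t ht ->] := MVT_segment h0 (fun t ht => dg t (itv t (itvo t ht)))
    (cg _ _ itv).
  rewrite subr0 [h * c]mulrC -mulrBl normrM ler_wpM2r//.
  by have [] := fh _ (itv _ ht).
have itv (t : R) : t \in `[h, 0]%R -> `|t| <= `|h|.
  rewrite in_itv /= => /andP[t0 th].
  by rewrite !ler0_norm// ?lerN2// ltW.
have itvo (t : R) : t \in `]h, 0[%R -> t \in `[h, 0]%R by exact: subset_itvW.
have [t ht E] := MVT_segment (ltW h0) (fun t ht => dg t (itv t (itvo t ht)))
    (cg _ _ itv).
rewrite -(opprB (g 0)) E sub0r mulrN opprK [h * c]mulrC -mulrBl normrM.
by rewrite ler_wpM2r//; have [] := fh _ (itv _ ht).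
Qed.

Lemma dotv_linear (c : 'rV[R]_m) : linear (dotv c).
Proof.
move=> k u v; rewrite /dotv scaler_sumr -big_split /=; apply: eq_bigr => a _.
by rewrite !mxE mulrDr mulrCA.
Qed.

Lemma dotv_continuous (c : 'rV[R]_m) : continuous (dotv c).
Proof.
apply: continuous_big => [|a _ x]; first exact: add_continuous.
by apply: continuousM; [exact: cst_continuous|exact: coord_continuous].
Qed.

Lemma gradient_differentiable f x (c : 'rV[R]_m) :
  (forall e, 0 < e -> \forall h \near (0 : 'rV[R]_m),
     `|f (h + x) - f x - dotv c h| <= e * `|h|) ->
  differentiable f x.
Proof.
move=> fx; pose lin := GRing.isLinear.Build _ _ _ _ _ (dotv_linear c).
pose L : {linear 'rV[R]_m -> R} := HB.pack (dotv c) lin.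
exact: (@linear_approx_differentiable R 'rV[R]_m R f L x
  (@dotv_continuous c) fx).
Qed.

Lemma coord_le_norm v i : `|v ord0 i| <= `|v|.
Proof.
rewrite [leRHS]/Num.Def.normr /= mx_normrE.
exact: (le_bigmax _ (fun ij => `|v ij.1 ij.2|) (ord0, i)).
Qed.

Lemma partial_differentiable f x :
  (forall a, \forall y \near x, derivable f y (basis_vec R a)) ->
  (forall a, {for x, continuous ('D_(basis_vec R a) f)}) ->
  differentiable f x.
Proof.
move=> df cf; apply: (@gradient_differentiable _ _
  (\row_a 'D_(basis_vec R a) f x)) => e e0.
set c := \row_a _.
(* Each of the m coordinate moves gets one share of the error; the divisor m + 1 is nonzero even for
   m = 0. *)
have e'0 : 0 < e / m.+1%:R by rewrite divr_gt0.
have : \forall y \near x, forall a, derivable f y (basis_vec R a) /\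
    `|'D_(basis_vec R a) f y - c ord0 a| <= e / m.+1%:R.
  apply: (@filter_forall _ _ _ (nbhs x)) => a; apply: filterS2 (df a) _ => [y fy|].
    by move=> Dy; split; [exact: fy|exact: Dy].
  by have /cvgrPdistC_le/(_ _ e'0) := cf a; rewrite mxE.
move=> /nbhs_ballP[r /= r0 xr]; apply/nbhs_ballP; exists r => //= h /= [_ hr].
(* The points [tr k + x] form a path from x to h + x changing one coordinate at a time; it stays in
   the ball because the norm is the maximum norm. *)
pose tr k : 'rV[R]_m := \row_j (if (j < k)%N then h ord0 j else 0).
have trS (k : 'I_m) : tr k.+1 = h ord0 k *: basis_vec R k + tr k.
  apply/rowP => j; rewrite !mxE /= ltnS leq_eqVlt.
  rewrite val_eqE; have [->|jk] := eqVneq j k; last by rewrite mulr0 add0r.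
  by rewrite ltnn mulr1 addr0.
have tr_ball k : (k <= m)%N ->
    `|f (tr k + x) - f x - \sum_(a < m | (a < k)%N) c ord0 a * h ord0 a|
    <= e / m.+1%:R * k%:R * `|h|.
  elim: k => [_|k IH km].
    rewrite big_pred0 // subr0 mulr0 mul0r.
    rewrite (_ : tr 0%N = 0) ?add0r ?subrr ?normr0//.
    by apply/rowP => j; rewrite !mxE.
  pose i := Ordinal km.
  have := @line_increment f (tr k + x) (basis_vec R i) (c ord0 i)
    (e / m.+1%:R) (h ord0 i).
  rewrite addrA -trS => li.
  have {li} li : `|f (tr k.+1 + x) - f (tr k + x) - h ord0 i * c ord0 i| <=
      e / m.+1%:R * `|h|.
    apply: le_trans (li _) _; last by rewrite ler_wpM2l ?coord_le_norm ?ltW.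
    move=> t th; apply: xr; split => // i0 j; rewrite !ord1 {i0}.
    rewrite /ball /= !mxE distrC addrA addrK.
    have [->|ji] := eqVneq j i.
      rewrite ltnn addr0 mulr1 (le_lt_trans th)//.
      by have := hr ord0 i; rewrite /ball /= mxE sub0r normrN.
    rewrite mulr0 add0r; have := hr ord0 j; rewrite /ball /= mxE sub0r normrN.
    by case: ifP => // _ _; rewrite normr0.
  have -> : \sum_(a < m | (a < k.+1)%N) c ord0 a * h ord0 a =
      h ord0 i * c ord0 i + \sum_(a < m | (a < k)%N) c ord0 a * h ord0 a.
    rewrite (bigD1 i) //= mulrC; congr (_ + _); apply: eq_bigl => j.
    by rewrite -val_eqE /= ltnS [RHS]ltn_neqAle andbC.
  have := lerD li (IH (ltnW km)); rewrite -mulrDl -[X in X + _ * _]mulr1 -mulrDr.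
  rewrite nat1r; apply: le_trans; apply: le_trans (ler_normD _ _).
  by rewrite le_eqVlt; apply/orP; left; apply/eqP; congr `|_|; ring.
have := tr_ball m (leqnn m).
have -> : tr m = h by apply/rowP => j; rewrite mxE ltn_ord.
under eq_bigl do rewrite ltn_ord.
move=> /le_trans; apply; rewrite ler_wpM2r// -mulrA ger_pMr//.
by rewrite ler_pdivrMl// mulr1 ler_nat.
Qed.

End partial_derivatives.

(** * Calculus of C^1 functions and Nash twists *)

Section C1_calculus.
Variables (R : realType) (m : nat).
Implicit Types (f g : 'rV[R]_m -> R) (x v w : 'rV[R]_m).

Definition C1 f := (forall x, differentiable f x) /\
  forall v, continuous ('D_v f).

Lemma derive_sum_basis f x v : differentiable f x ->
  'D_v f x = \sum_(a < m) v ord0 a * 'D_(basis_vec R a) f x.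
Proof.
move=> df; rewrite deriveE// {1}(row_sum_delta v) linear_sum.
by apply: eq_bigr => a _; rewrite linearZ /= -deriveE.
Qed.

Lemma C1_is_derive f x v : C1 f -> is_derive x v f ('D_v f x).
Proof. by move=> [df _]; apply: derivableP; exact: diff_derivable. Qed.

Lemma C1_intro f (df : 'rV[R]_m -> 'rV[R]_m -> R) :
  (forall x, differentiable f x) -> (forall x v, 'D_v f x = df v x) ->
  (forall v, continuous (df v)) -> C1 f.
Proof.
by move=> fd fE dfc; split => // v; rewrite (_ : 'D_v f = df v)//; exact/funext.
Qed.

Lemma C1_cst k : C1 (cst k : 'rV[R]_m -> R).
Proof.
apply: (@C1_intro _ (fun _ _ => 0)) => [x|x v|v]; first exact: differentiable_cst.
  by rewrite derive_cst.
exact: cst_continuous.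
Qed.

Lemma C1D f g : C1 f -> C1 g -> C1 (f \+ g).
Proof.
move=> Cf Cg; apply: (@C1_intro _ (fun v x => 'D_v f x + 'D_v g x)).
- by move=> x; apply: differentiableD; [exact: Cf.1|exact: Cg.1].
- move=> x v; have cf := C1_is_derive x v Cf; have cg := C1_is_derive x v Cg.
  by rewrite deriveD//; exact: ex_derive.
- by move=> v x; apply: (@continuousD _ _ _ ('D_v f) ('D_v g));
     [exact: Cf.2|exact: Cg.2].
Qed.

Lemma derive_prod f g x v : C1 f -> C1 g ->
  'D_v (f \* g) x = f x * 'D_v g x + g x * 'D_v f x.
Proof.
move=> Cf Cg; have cf := C1_is_derive x v Cf; have cg := C1_is_derive x v Cg.
by rewrite deriveM//; exact: ex_derive.
Qed.

Lemma C1M f g : C1 f -> C1 g -> C1 (f \* g).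
Proof.
move=> Cf Cg; apply: (@C1_intro _
  (fun v x => f x * 'D_v g x + g x * 'D_v f x)).
- by move=> x; apply: differentiableM; [exact: Cf.1|exact: Cg.1].
- by move=> x v; exact: derive_prod.
- move=> v x; apply: (@continuousD _ _ _ (f \* 'D_v g) (g \* 'D_v f)).
    apply: continuousM; last exact: Cg.2.
    by apply: differentiable_continuous; exact: Cf.1.
  apply: continuousM; last exact: Cf.2.
  by apply: differentiable_continuous; exact: Cg.1.
Qed.

Lemma C1_sum (I : Type) (r : seq I) (F : I -> 'rV[R]_m -> R) :
  (forall i, C1 (F i)) -> C1 (fun x => \sum_(i <- r) F i x).
Proof.
move=> CF; elim: r => [|i r IH].
  by under eq_fun do rewrite big_nil; exact: C1_cst.
by under eq_fun do rewrite big_cons; exact: (C1D (CF i) IH).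
Qed.

Lemma is_derive_differentiable (phi : R -> R) (d t : R) :
  is_derive t 1 phi d -> differentiable phi t.
Proof. by move=> dphi; apply/derivable1_diffP; exact: ex_derive. Qed.

Lemma derive_comp1 (phi dphi : R -> R) f x v :
  (forall t : R, is_derive t 1 phi (dphi t)) -> C1 f ->
  'D_v (phi \o f) x = dphi (f x) * 'D_v f x.
Proof.
move=> dp Cf; have pd := is_derive_differentiable (dp (f x)).
have fd := Cf.1 x.
rewrite deriveE; last exact: differentiable_comp.
rewrite diff_comp//= deriv1E; last exact: ex_derive.
rewrite -deriveE// [LHS]/GRing.scale /=.
rewrite mulrC derive1E; have -> // := @derive_val _ _ _ _ _ _ _ (dp (f x)).
Qed.

Lemma C1_comp (phi dphi : R -> R) f :
  (forall t : R, is_derive t 1 phi (dphi t)) -> continuous dphi -> C1 f ->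
  C1 (phi \o f).
Proof.
move=> dp cd Cf; apply: (@C1_intro _ (fun v x => dphi (f x) * 'D_v f x)).
- move=> x; apply: differentiable_comp; first exact: Cf.1.
  exact: is_derive_differentiable.
- by move=> x v; exact: derive_comp1.
- move=> v x; apply: (@continuousM _ _ (dphi \o f)); last exact: Cf.2.
  apply: continuous_comp; last exact: cd.
  by apply: differentiable_continuous; exact: Cf.1.
Qed.

Lemma C1_sin f : C1 f -> C1 (fun x => sin (f x)).
Proof. by apply: (C1_comp (@is_derive_sin R)); exact: continuous_cos. Qed.

Lemma C1_cos f : C1 f -> C1 (fun x => cos (f x)).
Proof.
apply: (C1_comp (@is_derive_cos R)) => t; apply: continuousN.
exact: continuous_sin.
Qed.

Lemma dotv_diff w x :
  differentiable (dotv w) x /\ forall v, 'D_v (dotv w) x = dotv w v.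
Proof.
pose lin := GRing.isLinear.Build _ _ _ _ _ (dotv_linear w).
pose L : {linear 'rV[R]_m -> R} := HB.pack (dotv w) lin.
have cL : continuous L by exact: dotv_continuous.
have dL : differentiable L x by exact: linear_differentiable.
by split => // v; rewrite (deriveE _ dL) diff_lin.
Qed.

Lemma C1_dotv w : C1 (dotv w).
Proof.
apply: (@C1_intro _ (fun v _ => dotv w v)) => [x|x v|v].
- by have [] := dotv_diff w x.
- by have [_ ->] := dotv_diff w x.
- exact: cst_continuous.
Qed.

Lemma dotv_delta a v : dotv (basis_vec R a) v = v ord0 a.
Proof.
rewrite /dotv (bigD1 a)//= big1 ?addr0 ?mxE ?eqxx ?mul1r//.
by move=> j ja; rewrite !mxE (negPf ja) andbF mul0r.
Qed.

Lemma C1_coord a : C1 (fun x => x ord0 a).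
Proof.
by under eq_fun do rewrite -dotv_delta; exact: C1_dotv.
Qed.

(* Nash's twist: a fast rotation makes the derivative of the amplitude
   negligible. *)
Lemma nash_twist (a : 'rV[R]_m -> R) w (l : R) : l != 0 -> C1 a ->
  exists f g, [/\ C1 f, C1 g, forall x, a x = 0 -> f x = 0 /\ g x = 0 &
    forall x v, 'D_v f x ^+ 2 + 'D_v g x ^+ 2 =
      a x ^+ 2 * dotv w v ^+ 2 + ('D_v a x) ^+ 2 / l ^+ 2].
Proof.
move=> l0 Ca; pose u := cst l \* dotv w.
have Cu : C1 u by apply: C1M; [exact: C1_cst|exact: C1_dotv].
have uE x v : 'D_v u x = l * dotv w v.
  rewrite derive_prod ?derive_cst ?mulr0 ?addr0; [|exact: C1_cst|exact: C1_dotv].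
  by have [_ ->] := dotv_diff w x.
pose b := cst l^-1 \* a.
have Cb : C1 b by apply: C1M => //; exact: C1_cst.
have bE x v : 'D_v b x = l^-1 * 'D_v a x.
  by rewrite derive_prod ?derive_cst ?mulr0 ?addr0 //; exact: C1_cst.
have Cc := C1_cos Cu; have Cs := C1_sin Cu.
exists (b \* (fun x => cos (u x))), (b \* (fun x => sin (u x))); split.
- exact: C1M.
- exact: C1M.
- by move=> x ax; rewrite /b /= ax mulr0 !mul0r.
- move=> x v; rewrite (derive_prod _ _ Cb Cc) (derive_prod _ _ Cb Cs) bE.
  have -> := derive_comp1 x v (@is_derive_cos R) Cu.
  have -> := derive_comp1 x v (@is_derive_sin R) Cu.
  rewrite uE /b /=.
  have cs := cos2Dsin2 (u x).
  rewrite -[RHS]mul1r -cs; field.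
  by rewrite l0.
Qed.

Definition sqdiff (fs : seq ('rV[R]_m -> R)) x v : R :=
  \sum_(f <- fs) 'D_v f x ^+ 2.

(** One twist for each linear form, all with the same amplitude: the main terms add up to a
    quadratic form and the errors are n equal copies. *)
Lemma nash_twists n (w : 'I_n -> 'rV[R]_m) (a : 'rV[R]_m -> R) (l : R) :
  l != 0 -> C1 a ->
  exists fs : seq ('rV[R]_m -> R),
    [/\ forall f, f \in fs -> C1 f,
        forall f x, f \in fs -> a x = 0 -> f x = 0 &
        forall x v, sqdiff fs x v = a x ^+ 2 * (\sum_j dotv (w j) v ^+ 2)
          + n%:R * ('D_v a x) ^+ 2 / l ^+ 2].
Proof.
move=> l0 Ca; elim: n w => [|n IH] w.
  exists [::]; split => // x v.
  by rewrite /sqdiff big_nil big_ord0 mulr0 !mul0r addr0.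
have [fs [Cfs fs0 fsE]] := IH (fun j => w (lift ord0 j)).
have [f [g [Cf Cg fg0 fgE]]] := nash_twist (w ord0) l0 Ca.
exists [:: f, g & fs]; split.
- by move=> h; rewrite !inE => /or3P[/eqP->|/eqP->|/Cfs].
- move=> h x; rewrite !inE => /or3P[/eqP->|/eqP->|hfs].
  + by move=> /fg0[].
  + by move=> /fg0[].
  + exact: fs0.
- move=> x v; rewrite /sqdiff !big_cons addrA fgE -/(sqdiff fs x v) fsE.
  by rewrite big_ord_recl -natr1; ring.
Qed.

Lemma dotv_CauchySchwarz u v : dotv u v ^+ 2 <= dotv u u * dotv v v.
Proof.
have psd1 : psd (1%:M : 'M[R]_m).
  split; first exact: trmx1.
  move=> z; rewrite /qform bformE mulmx1 -dotvE.
  by apply: sumr_ge0 => i _; rewrite -expr2 sqr_ge0.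
have := psd_CauchySchwarz u v psd1.
by rewrite /qform !bformE !mulmx1 -!dotvE.
Qed.

(** Cauchy-Schwarz reduces the bound to the squared gradient, which is continuous and so bounded on
    the compact set. *)
Lemma derive_bound f (L : set 'rV[R]_m) : compact L -> C1 f ->
  exists2 B, 0 <= B & forall x v, L x ->
    'D_v f x ^+ 2 <= B * \sum_a v ord0 a ^+ 2.
Proof.
move=> cL Cf; pose G x := \sum_a 'D_(basis_vec R a) f x ^+ 2.
have cG : continuous G.
  apply: continuous_big => [|a _ x]; first exact: add_continuous.
  by apply: (@continuousM _ _ ('D_(basis_vec R a) f)); exact: Cf.2.
have [B B0 GB] : exists2 B, 0 <= B & forall x, L x -> G x <= B.
  have [->|/set0P L0] := eqVneq L set0; first by exists 0.
  have [c _ cG'] := EVT_max_rV L0 cL (continuous_subspaceT cG).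
  exists (G c); first by apply: sumr_ge0 => a _; exact: sqr_ge0.
  by move=> x Lx; apply: cG'; exact: mem_set.
exists B => // x v Lx; rewrite (derive_sum_basis _ (Cf.1 x)).
pose u := \row_a 'D_(basis_vec R a) f x.
have -> : \sum_a v ord0 a * 'D_(basis_vec R a) f x = dotv u v.
  by apply: eq_bigr => a _; rewrite mxE mulrC.
apply: le_trans (dotv_CauchySchwarz _ _) _.
have -> : dotv u u = G x by apply: eq_bigr => a _; rewrite mxE expr2.
rewrite (_ : dotv v v = \sum_a v ord0 a ^+ 2) ?ler_wpM2r ?GB//.
by apply: sumr_ge0 => a _; exact: sqr_ge0.
Qed.

(** * C^1 bumps supported in Euclidean balls *)

Definition sqdist (x0 x : 'rV[R]_m) : R := dotv (x - x0) (x - x0).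

Definition pos2 (t : R) : R := Num.max 0 t ^+ 2.

(** The error is quadratic in h uniformly in t, so the derivative at the corner t = 0 needs no
    separate treatment. *)
Lemma pos2_increment (t h : R) :
  `|pos2 (h + t) - pos2 t - h * (2 * Num.max 0 t)| <= `|h| ^+ 2.
Proof.
rewrite real_normK ?num_real// ler_norml /pos2 !expr2.
have [t0|t0] := leP 0 t; have [ht0|ht0] := leP 0 (h + t).
all: by apply/andP; split; nra.
Qed.

Lemma is_derive_pos2 (t : R) : is_derive t 1 pos2 (2 * Num.max 0 t).
Proof.
have cv : h^-1 *: ((pos2 \o shift t) h%:A - pos2 t) @[h --> 0^'] -->
    2 * Num.max 0 t.
  apply/cvgrPdistC_le => e e0; near=> h.
  have h0 : h != 0 by near: h; exact: nbhs_dnbhs_neq.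
  have he : `|h| <= e.
    by near: h; apply: (filterS _ (dnbhs0_lt e0)) => y /ltW.
  rewrite /= [h%:A]mulr1 [_ *: _]mulrC -[X in _ - X](mulfK h0) -mulrBl.
  rewrite normrM normfV ler_pdivrMr ?normr_gt0// [X in _ - X]mulrC.
  apply: le_trans (pos2_increment t h) _.
  by rewrite expr2 ler_wpM2r.
by apply: DeriveDef; [apply/cvg_ex; eexists; exact: cv|exact/cvg_lim].
Unshelve. all: by end_near. Qed.

Lemma pos2_continuous : continuous (fun t : R => 2 * Num.max 0 t).
Proof.
move=> t; apply: (@continuousM _ _ (cst 2)); first exact: cst_continuous.
apply: continuous_max; [exact: cst_continuous|exact: cvg_id].
Qed.

Lemma C1_sqdist x0 : C1 (sqdist x0).
Proof.
have -> : sqdist x0 = (fun x => \sum_a ((x ord0 a + - x0 ord0 a) *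
    (x ord0 a + - x0 ord0 a))).
  by apply/funext => x; apply: eq_bigr => a _; rewrite !mxE.
apply: C1_sum => a.
have Ca : C1 (fun x => x ord0 a + - x0 ord0 a).
  by apply: (C1D (C1_coord a)); exact: C1_cst.
exact: (C1M Ca Ca).
Qed.

Lemma sqdist_coord x0 x a : (x ord0 a - x0 ord0 a) ^+ 2 <= sqdist x0 x.
Proof.
rewrite /sqdist /dotv (bigD1 a)//= !mxE -expr2 lerDl.
by apply: sumr_ge0 => i _; rewrite -expr2 sqr_ge0.
Qed.

Lemma sqdist_ge0 x0 x : 0 <= sqdist x0 x.
Proof. by apply: sumr_ge0 => i _; rewrite -expr2 sqr_ge0. Qed.

Lemma sqdistxx x0 : sqdist x0 x0 = 0.
Proof. by rewrite /sqdist dotvE subrr mul0mx mxE. Qed.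

Lemma C1_continuous f : C1 f -> continuous f.
Proof. by move=> [fd _] x; exact: differentiable_continuous. Qed.

Lemma sqdist_ball_compact x0 r : compact [set x | sqdist x0 x <= r ^+ 2].
Proof.
apply: (@subclosed_compact _ [set x | sqdist x0 x <= r ^+ 2]
  [set x : 'rV[R]_m | forall a, x ord0 a \in `[x0 ord0 a - `|r|, x0 ord0 a + `|r|]]).
- apply: (@closed_comp _ _ (sqdist x0) [set t | t <= r ^+ 2]).
    by move=> x _; exact: (C1_continuous (C1_sqdist x0)).
  exact: closed_le.
- apply: (@rV_compact _ _
    (fun a => `[x0 ord0 a - `|r|, x0 ord0 a + `|r|]%classic)) => a.
  exact: segment_compact.
- move=> x /= xr a; have := le_trans (sqdist_coord x0 x a) xr.
  rewrite -[leRHS]real_normK ?num_real// -[leLHS]real_normK ?num_real//.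
  by rewrite ler_sqr ?nnegrE// ler_distl in_itv.
Qed.

(** For r > 0, a bump with values in [0, 1], vanishing outside the ball of radius r and at least 1/4
    where the squared distance is at most r^2 / 2. *)
Definition bumpv x0 (r : R) x : R := pos2 (1 - sqdist x0 x / r ^+ 2).

Lemma C1_bump x0 r : C1 (bumpv x0 r).
Proof.
apply: (C1_comp is_derive_pos2 pos2_continuous).
apply: (C1D (C1_cst 1)).
have -> : (fun x => - (sqdist x0 x / r ^+ 2)) =
    cst (- (r ^+ 2)^-1) \* sqdist x0.
  by apply/funext => x /=; rewrite mulrC mulNr.
exact: (C1M (C1_cst _) (C1_sqdist x0)).
Qed.

Lemma bump_out x0 r x : 0 < r -> r ^+ 2 <= sqdist x0 x -> bumpv x0 r x = 0.
Proof.
move=> r0 xr; rewrite /bumpv /pos2 max_l ?expr0n//.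
by rewrite subr_le0 ler_pdivlMr ?mul1r// exprn_gt0.
Qed.

Lemma bump_le1 x0 r x : bumpv x0 r x <= 1.
Proof.
have t1 : 1 - sqdist x0 x / r ^+ 2 <= 1.
  by rewrite gerBl divr_ge0// ?sqr_ge0// sqdist_ge0.
rewrite /bumpv /pos2 expr_le1// ?le_max ?lexx// ge_max ler01.
by rewrite t1.
Qed.

Lemma bump_in x0 r x : 0 < r -> sqdist x0 x <= r ^+ 2 / 2 ->
  4^-1 <= bumpv x0 r x.
Proof.
move=> r0 xr; have r20 : 0 < r ^+ 2 by rewrite exprn_gt0.
have t1 : 2^-1 <= 1 - sqdist x0 x / r ^+ 2.
  have : sqdist x0 x / r ^+ 2 <= 2^-1 by rewrite ler_pdivrMr// mulrC.
  lra.
rewrite /bumpv /pos2 max_r; last by apply: le_trans t1; rewrite invr_ge0.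
by rewrite expr2; nra.
Qed.

End C1_calculus.

(** * One step in a chart *)

Section euclidean_step.
Variables (R : realType) (m : nat) (U : set 'rV[R]_m) (H : 'rV[R]_m -> 'M[R]_m).
Hypothesis Hpos : forall x, U x -> posdef (H x).
Implicit Types (f C : 'rV[R]_m -> R) (x v : 'rV[R]_m).

(** A pair of a centre and a radius. Comparability up to a factor 2 is the precise sense in which
    [H] is nearly constant on the cell. *)
Definition good_cell (c : 'rV[R]_m * R) := 0 < c.2 /\
  forall x, sqdist c.1 x <= c.2 ^+ 2 -> U x /\ forall v,
    qform (H c.1) v <= 2 * qform (H x) v /\ qform (H x) v <= 2 * qform (H c.1) v.

(** The complement of the amplitude [sin (bumpv c.1 c.2 x)]: multiplying [C] by this cosine lowers
    C^2 by exactly the square of C times that sine. *)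
Definition bump_cos (c : 'rV[R]_m * R) x : R := cos (bumpv c.1 c.2 x).

Lemma C1_bump_cos c : C1 (bump_cos c).
Proof. by apply: C1_cos; exact: C1_bump. Qed.

Lemma qform_ge0 x v : U x -> 0 <= qform (H x) v.
Proof. by move=> /Hpos/posdef_psd[_]. Qed.

Lemma qformZ (k : R) (A : 'M[R]_m) v : qform (k *: A) v = k * qform A v.
Proof. by rewrite /qform !bformE -scalemxAr -scalemxAl mxE. Qed.

(** The twists have amplitude C sin(bump), whose square is [s], and carry a quarter of the constant
    form at the centre. The factor 2 of the good cell turns s/4 into the bounds s/8 and s/2, and a
    large frequency makes the error at most t times the form. *)
Lemma cell_twists c C (t : R) : good_cell c -> C1 C -> 0 < t ->
  exists fs : seq ('rV[R]_m -> R),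
    [/\ forall f, f \in fs -> C1 f,
        forall f x, f \in fs -> c.2 ^+ 2 <= sqdist c.1 x -> f x = 0 &
        forall x v, U x ->
          let s := C x ^+ 2 - (C x * bump_cos c x) ^+ 2 in
          s / 8 * qform (H x) v <= sqdiff fs x v <= (s / 2 + t) * qform (H x) v].
Proof.
case: c => x0 r [/= r0 cell] CC t0.
have [Ux0 _] := cell x0 (ltac:(by rewrite sqdistxx sqr_ge0)).
have pA := Hpos Ux0; have psA := posdef_psd pA.
pose L := [set x | sqdist x0 x <= r ^+ 2].
have cL : compact L by exact: sqdist_ball_compact.
pose a := C \* (fun x => sin (bumpv x0 r x)).
have Ca : C1 a by apply: C1M => //; apply: C1_sin; exact: C1_bump.
have [B B0 aB] := derive_bound cL Ca.
have [K K0 HK] := posdef_coercive pA.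
have [w wE] : exists w : 'I_m -> 'rV[R]_m,
    forall v, 4^-1 * qform (H x0) v = \sum_j dotv (w j) v ^+ 2.
  have [|w wE] := @psd_sum_squares _ _ (4^-1 *: H x0).
    split; first by rewrite linearZ /= psA.1.
    by move=> v; rewrite qformZ mulr_ge0// psA.2.
  by exists w => v; rewrite -wE qformZ.
(* In the cell, m times the squared derivative of [a] is at most m [B] [K] 2 [qform (H x) v], which
   is t [M] [qform (H x) v]; so a frequency with square at least [M] suffices. *)
pose M := m%:R * B * K * 2 / t.
have M0 : 0 <= M by rewrite /M !mulr_ge0// invr_ge0 ltW.
pose l := M + 1; have l0 : l != 0 by rewrite gt_eqF// ltr_wpDl.
have lM : M <= l ^+ 2 by rewrite /l; nra.
have l20 : 0 < l ^+ 2 by rewrite exprn_even_gt0.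
have [fs [Cfs fs0 fsE]] := nash_twists w l0 Ca.
have a0 x : r ^+ 2 <= sqdist x0 x -> a x = 0.
  by move=> xr; rewrite /a /= bump_out// sin0 mulr0.
exists fs; split => //.
  by move=> f x ffs /a0; exact: fs0.
move=> x v Ux; rewrite fsE -wE.
set s := C x ^+ 2 - (C x * bump_cos (x0, r) x) ^+ 2.
have Q0 := qform_ge0 v Ux; have QA0 := psA.2 v.
have sE : s = a x ^+ 2.
  rewrite /s /a /bump_cos /= !exprMn.
  have := cos2Dsin2 (bumpv x0 r x); set cc := cos _ ^+ 2; set ss := sin _ ^+ 2.
  by move=> cs; rewrite -(addKr cc ss) cs; ring.
rewrite sE; have [xr|xr] := leP (sqdist x0 x) (r ^+ 2); last first.
  (* Off the closed ball the amplitude vanishes on a neighbourhood of x, so its derivative vanishes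
     too. *)
  have -> : 'D_v a x = 0.
    rewrite -(derive_cst (0 : R) x v); apply: near_eq_derive.
    near=> y; rewrite a0//; apply/ltW; near: y.
    have := C1_continuous (C1_sqdist x0) (x := x).
    move=> /cvgr_gt; exact.
  by rewrite a0 ?(ltW xr)// expr0n /= !(mul0r, mulr0) !add0r lexx mulr_ge0 ?(ltW t0).
have [_ /(_ v)[Q1 Q2]] := cell _ xr.
have as0 : 0 <= a x ^+ 2 by exact: sqr_ge0.
have err : m%:R * 'D_v a x ^+ 2 / l ^+ 2 <= t * qform (H x) v.
  rewrite ler_pdivrMr// -mulrA.
  have h1 : 'D_v a x ^+ 2 <= B * (K * (2 * qform (H x) v)).
    apply: le_trans (aB _ _ xr) _; rewrite ler_wpM2l//.
    by apply: le_trans (HK v) _; rewrite ler_wpM2l.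
  apply: le_trans (ler_wpM2l (ler0n _ m) h1) _.
  have -> : m%:R * (B * (K * (2 * qform (H x) v))) = t * (qform (H x) v * M).
    rewrite /M; field.
    by rewrite gt_eqF.
  by rewrite ler_wpM2l ?(ltW t0)// ler_wpM2l.
have err0 : 0 <= m%:R * 'D_v a x ^+ 2 / l ^+ 2.
  by rewrite divr_ge0 ?(ltW l20)// mulr_ge0// sqr_ge0.
apply/andP; split; nra.
Unshelve. all: by end_near. Qed.

(* The product [C] of the cosines of the bumps telescopes: [1 - C^2] is the sum
   of the squares of the amplitudes used in the successive cells. *)
Lemma cells_twists (cs : seq ('rV[R]_m * R)) :
  (forall c, c \in cs -> good_cell c) ->
  exists fs C (t : R) (L : set 'rV[R]_m),
    [/\ 0 < t, compact L /\ L `<=` U,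
        C1 C /\ (forall x, 0 <= C x ^+ 2 <= 1),
        (forall c x, c \in cs -> C x ^+ 2 <= bump_cos c x ^+ 2) &
        [/\ forall f, f \in fs -> C1 f,
            forall f x, f \in fs -> ~ L x -> f x = 0 &
            forall x v, U x ->
              (1 - C x ^+ 2) / 8 * qform (H x) v <= sqdiff fs x v /\
              sqdiff fs x v <= (1 - t - C x ^+ 2 / 2) * qform (H x) v]].
Proof.
elim: cs => [_|c cs IH good].
  (* With C = 1 and t = 1/2 the upper coefficient 1 - t - C^2 / 2 is exactly 0. *)
  exists [::], (cst 1), 2^-1, set0; split => //.
  - by split; [exact: compact0|].
  - by split; [exact: C1_cst|move=> x; rewrite expr1n ler01 lexx].
  split => // x v Ux; rewrite /sqdiff big_nil expr1n subrr mul0r mul0r.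
  by split => //; rewrite (_ : _ - _ = 0) ?mul0r//; field.
have [|fs [C [t [L [t0 [cL LU] [CC C01] Ccs [Cfs fsL fsE]]]]]] := IH.
  by move=> d dcs; apply: good; rewrite inE dcs orbT.
have gc := good c (mem_head _ _).
(* The new cell may spend half of the reserve t; the other half keeps the total strictly below the
   form. *)
have t20 : 0 < t / 2 by rewrite divr_gt0.
have [gs [Cgs gs0 gsE]] := cell_twists gc CC t20.
have cos01 x : 0 <= bump_cos c x ^+ 2 <= 1.
  rewrite sqr_ge0 /= -(cos2Dsin2 (bumpv c.1 c.2 x)) lerDl.
  exact: sqr_ge0.
exists (gs ++ fs), (C \* bump_cos c), (t / 2),
  (L `|` [set x | sqdist c.1 x <= c.2 ^+ 2]); split => //.
- split; first by apply: compactU => //; exact: sqdist_ball_compact.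
  by move=> x [/LU//|/(gc.2)[]].
- split; first by apply: C1M => //; exact: C1_bump_cos.
  move=> x /=; rewrite exprMn; have /andP[? ?] := C01 x.
  by have /andP[? ?] := cos01 x; rewrite mulr_ge0//= mulr_ile1.
- move=> d x; rewrite inE /= exprMn => /predU1P[->|dcs].
    by rewrite ler_piMl//; [have /andP[] := cos01 x|have /andP[] := C01 x].
  apply: le_trans (Ccs _ _ dcs); rewrite ler_piMr//; first exact: sqr_ge0.
  by have /andP[] := cos01 x.
split.
- by move=> f; rewrite mem_cat => /orP[/Cgs|/Cfs].
- move=> f x; rewrite mem_cat => /orP[fgs|ffs] /not_orP[nL nc].
    by apply: gs0 => //; apply/ltW; rewrite ltNge; exact/negP.
  exact: fsL.
- move=> x v Ux; rewrite /sqdiff big_cat -!/(sqdiff _ x v).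
  have [f1 f2] := fsE x v Ux; have /andP[g1 g2] := gsE x v Ux.
  split; [apply: le_trans (lerD g1 f1)|apply: (le_trans (lerD g2 f2))].
    by rewrite -mulrDl le_eqVlt; apply/orP; left; apply/eqP; congr (_ * _) => /=; field.
  by rewrite -mulrDl le_eqVlt; apply/orP; left; apply/eqP; congr (_ * _) => /=; field.
Qed.

Hypothesis Hcont : forall a b x, U x -> {for x, continuous (fun y => H y a b)}.

Lemma good_cell_exists x0 : open U -> U x0 ->
  exists2 r : R, 0 < r & good_cell (x0, r).
Proof.
move=> oU Ux0; have [e e0 He] := posdef_near (Hpos Ux0).
have near_e : \forall y \near x0, forall ab : 'I_m * 'I_m,
    `|H y ab.1 ab.2 - H x0 ab.1 ab.2| <= e.
  apply: (@filter_forall _ _ _ (nbhs x0)) => -[a b] /=.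
  by have /cvgrPdistC_le/(_ _ e0) := @Hcont a b _ Ux0.
have near_U : \forall y \near x0, U y by exact: open_nbhs_nbhs.
have : \forall y \near x0, U y /\ forall ab : 'I_m * 'I_m,
    `|H y ab.1 ab.2 - H x0 ab.1 ab.2| <= e.
  exact: filterS2 (fun y Uy ey => conj Uy ey) near_U near_e.
move=> /nbhs_ballP[r /= r0 xr].
(* Halving puts the closed Euclidean ball inside the open ball of radius r for the maximum norm. *)
exists (r / 2); first by rewrite divr_gt0.
split; first by rewrite divr_gt0.
move=> x /= xr2; have [|Ux Hx] := xr x.
  split => // i a; rewrite ord1 /ball /= distrC.
  have := le_trans (sqdist_coord x0 x a) xr2.
  rewrite -[leLHS]real_normK ?num_real// ler_sqr ?nnegrE ?divr_ge0 ?(ltW r0)//.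
  by move=> /le_lt_trans; apply; rewrite ltr_pdivrMr// ltr_pMr// ltr1n.
by split => // v; apply: He => a b; exact: (Hx (a, b)).
Qed.

(** The universal constant d. At each point of the compact set some bump is at least 1/4, hence C^2
    is at most cos(1/4)^2 in the lower bound (1 - C^2) / 8. *)
Definition step_rate : R := (1 - cos 4^-1 ^+ 2) / 8.

(** Finitely many good cells are chosen so that their inner parts, where the bump is at least 1/4,
    cover [K]. The reserve t of [cells_twists] makes the upper bound strict. *)
Lemma euclidean_step (K : set 'rV[R]_m) : open U -> compact K -> K `<=` U ->
  exists (fs : seq ('rV[R]_m -> R)) (L : set 'rV[R]_m),
    [/\ compact L, L `<=` U, forall f, f \in fs -> C1 f,
        forall f x, f \in fs -> ~ L x -> f x = 0 &
        (forall x v, U x -> v != 0 -> sqdiff fs x v < qform (H x) v) /\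
        (forall x v, K x -> step_rate * qform (H x) v <= sqdiff fs x v)].
Proof.
move=> oU cK KU.
(* The value 1 off [U] is a default: every centre retained lies in [K], hence in [U]. *)
pose rad x0 : R := if pselect (U x0) is left Ux0 then
  sval (cid2 (good_cell_exists oU Ux0)) else 1.
have rad0 x0 : 0 < rad x0.
  by rewrite /rad; case: pselect => // Ux0; case: cid2.
have radP x0 : U x0 -> good_cell (x0, rad x0).
  by rewrite /rad; case: pselect => // Ux0 _; case: cid2.
pose O x0 := [set x | sqdist x0 x < rad x0 ^+ 2 / 2].
have [D DK KD] : finite_subset_cover K O K.
  move: (cK); rewrite compact_cover; apply.
    move=> x0 _; apply: (@open_comp _ _ (sqdist x0)
      [set t | t < rad x0 ^+ 2 / 2]); last exact: open_lt.
    by move=> x _; exact: (C1_continuous (C1_sqdist x0)).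
  by move=> x Kx; exists x => //; rewrite /O /= sqdistxx divr_gt0// exprn_gt0.
have [|fs [C [t [L [t0 [cL LU] [CC C01] Ccs [Cfs fsL fsE]]]]]] :=
    @cells_twists [seq (x0, rad x0) | x0 <- enum_fset D].
  by move=> c /mapP[x0 x0D ->]; apply/radP/KU; move: (DK _ x0D); rewrite in_setE.
exists fs, L; split => //; split => [x v Ux v0|x v Kx].
  have [_ /le_lt_trans] := fsE x v Ux; apply.
  have Q0 := (Hpos Ux).2 _ v0; rewrite gtr_pMl//.
  by have /andP[] := C01 x; lra.
apply: le_trans (fsE x v (KU _ Kx)).1.
apply: ler_wpM2r; first by apply: qform_ge0; exact: KU.
apply: ler_wpM2r; first by rewrite invr_ge0.
rewrite lerD2l lerN2; have [x0 x0D Ox] := KD _ Kx.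
apply: le_trans (Ccs (x0, rad x0) x (map_f _ x0D)) _.
have b1 := bump_le1 x0 (rad x0) x.
have b4 := bump_in (rad0 x0) (ltW Ox).
(* Since pi >= 2, both 1/4 and the bump value lie in [0, pi/2], where the cosine is nonnegative and
   decreasing. *)
have pi2 := pi_ge2 R.
have c0 : 0 <= bump_cos (x0, rad x0) x.
  by apply: cos_ge0_pihalf; apply/andP; split; lra.
rewrite ler_sqr ?nnegrE//.
  rewrite leNgt ltr_cos ?in_itv/=.
  - by rewrite -leNgt.
  - by apply/andP; split; lra.
  - by apply/andP; split; lra.
by apply: cos_ge0_pihalf; apply/andP; split; lra.
Qed.

End euclidean_step.

(** * Charts and changes of coordinates *)

Section local_differentiability.
Variables (R : realType) (m : nat).
Implicit Types (f g F : 'rV[R]_m -> R) (x y v : 'rV[R]_m) (W : set 'rV[R]_m).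

(** Stated at a point so as to depend only on the germ of f there: a function read through
    [chart_inv] has arbitrary values outside the chart image. *)
Definition C1_at f x := differentiable f x /\
  forall a, {for x, continuous ('D_(basis_vec R a) f)}.

Lemma near_open W f g x : open W -> W x -> (forall y, W y -> f y = g y) ->
  \forall y \near x, f y = g y.
Proof. by move=> oW Wx fg; apply: filterS fg _; exact: open_nbhs_nbhs. Qed.

Lemma continuous_near_eq (f g : 'rV[R]_m -> R) x :
  (\forall y \near x, f y = g y) -> {for x, continuous f} ->
  {for x, continuous g}.
Proof.
move=> fg cf; change (g @ x --> g x); rewrite -(nbhs_singleton fg).
exact: cvg_trans (near_eq_cvg fg) cf.
Qed.

Lemma C1_at_open W f g x : open W -> W x -> (forall y, W y -> f y = g y) ->
  (forall y a, W y -> derivable g y (basis_vec R a)) ->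
  (forall a, {for x, continuous ('D_(basis_vec R a) g)}) -> C1_at f x.
Proof.
move=> oW Wx fg dg cg.
have gf y : W y -> \forall z \near y, g z = f z.
  by move=> Wy; apply: (near_open oW) => // z Wz; rewrite fg.
have cf a : {for x, continuous ('D_(basis_vec R a) f)}.
  apply: continuous_near_eq (cg a).
  by apply: (near_open oW) => // y Wy; apply: near_eq_derive; exact: gf.
split => //; apply: partial_differentiable => // a.
apply: filterS (open_nbhs_nbhs (conj oW Wx)) => y Wy.
by apply: near_eq_derivable (gf _ Wy) _; exact: dg.
Qed.

Lemma differentiable_row (T : 'rV[R]_m -> 'rV[R]_m) x :
  (forall i, differentiable (fun y => T y ord0 i) x) -> differentiable T x.
Proof.
move=> dT; have -> : T = \sum_i (fun y => T y ord0 i *: (delta_mx ord0 i : 'rV[R]_m)).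
  by apply/funext => y; rewrite fct_sumE [LHS]row_sum_delta.
by apply: differentiable_sum => i; apply: differentiableZl.
Qed.

Lemma derive_chain F (T : 'rV[R]_m -> 'rV[R]_m) x v :
  differentiable T x -> differentiable F (T x) ->
  'D_v (F \o T) x = \sum_i 'D_v (fun y => T y ord0 i) x *
                           'D_(basis_vec R i) F (T x).
Proof.
move=> dT dF; rewrite deriveE; last exact: differentiable_comp.
rewrite diff_comp//= -[X in 'd F _ X]deriveE// -deriveE//.
rewrite derive_sum_basis//; apply: eq_bigr => i _.
by rewrite derive_mx ?mxE//; exact: diff_derivable.
Qed.

End local_differentiability.

(** * Transition maps and the transformation of differentials and metrics *)

Section transitions.
Variables (R : realType) (m : nat) (M : smooth_manifold R m).
Implicit Types (c : chart R M m) (f : M -> R) (p : M) (v : 'rV[R]_m).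

Lemma chart_img_nbhs c p : chart_dom c p -> nbhs (c p) (chart_img c).
Proof.
move=> cp; apply: open_nbhs_nbhs; split; first exact: chart_img_open.
by exists p.
Qed.

Lemma chart_inv_cts c x : chart_img c x -> {for x, continuous (chart_inv c)}.
Proof.
move=> cx; have := @chart_inv_continuous _ _ _ c.
rewrite continuous_open_subspace; last exact: chart_img_open.
by apply; exact: mem_set.
Qed.

Lemma chart_invK c x : chart_img c x ->
  chart_dom c (chart_inv c x) /\ c (chart_inv c x) = x.
Proof. by move=> [p cp <-]; rewrite chart_mapK. Qed.

Definition overlap c c' := c @` (chart_dom c `&` chart_dom c').

Lemma overlapP c c' x : overlap c c' x <->
  chart_img c x /\ chart_dom c' (chart_inv c x).
Proof.
split=> [[p [cp cp'] <-]|[[p cp <-]]].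
  by rewrite chart_mapK//; split => //; exists p.
by rewrite chart_mapK// => cp'; exists p.
Qed.

Lemma overlap_open c c' : open (overlap c c').
Proof.
rewrite openE => x /overlapP[cx cx'].
have n1 : nbhs x (chart_img c).
  by apply: open_nbhs_nbhs; split => //; exact: chart_img_open.
have n2 : nbhs x (chart_inv c @^-1` chart_dom c').
  apply: (chart_inv_cts cx); apply: open_nbhs_nbhs; split => //.
  exact: chart_dom_open.
apply: filterS2 n1 n2 => y cy cy'.
by apply/overlapP.
Qed.

Lemma smooth_C1_at W (f : 'rV[R]_m -> R) x : open W -> smooth_on W f -> W x ->
  C1_at f x.
Proof.
move=> oW /(_ 1%N) sf Wx; apply: (@C1_at_open _ _ W f f) => //.
  by move=> y a Wy; exact: (sf a).1.
move=> a; have := (sf a).2; rewrite /= continuous_open_subspace//; apply.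
exact: mem_set.
Qed.

Lemma transition_C1 c c' i x : smooth_transition c c' -> overlap c c' x ->
  C1_at (fun y => c' (chart_inv c y) ord0 i) x.
Proof.
move=> /(_ i) st xo;
 exact: (smooth_C1_at (@overlap_open c c') st xo).
Qed.

Lemma transition_differentiable c c' x : smooth_transition c c' ->
  overlap c c' x -> differentiable (c' \o chart_inv c) x.
Proof.
move=> st xo; apply: differentiable_row => i.
by have [] := transition_C1 i st xo.
Qed.

Definition mC1 f := forall c, local_coordinates c -> forall x, chart_img c x ->
  C1_at (f \o chart_inv c) x.

Definition grad c f p : 'rV[R]_m := \row_a pderive c a f p.

Definition dform c f p v : R := dotv (grad c f p) v.

(** Tangent vectors are rows: components [v] in c become [v *m jac c c' p] in c'. *)
Definition jac c c' p : 'M[R]_m := \matrix_(a, i) pderive c a (Defs.coord c' i) p.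

Lemma grad_change c c' f p : smooth_transition c c' ->
  chart_dom c p -> chart_dom c' p ->
  differentiable (f \o chart_inv c') (c' p) ->
  grad c f p = grad c' f p *m (jac c c' p)^T.
Proof.
move=> st cp cp' df; have op : overlap c c' (c p) by exists p.
apply/rowP => a; rewrite !mxE /pderive.
transitivity ('D_(basis_vec R a)
  ((f \o chart_inv c') \o (c' \o chart_inv c)) (c p)).
  apply: near_eq_derive; apply: (near_open (@overlap_open c c')) => // y.
  by move=> /overlapP[_ cy] /=; rewrite chart_mapK.
rewrite derive_chain; last 2 first.
- exact: transition_differentiable.
- by rewrite /= chart_mapK.
by apply: eq_bigr => i _; rewrite !mxE mulrC /= chart_mapK.
Qed.

(** With [qform_change], this transfers any comparison of g with sums of squared differentials from
    one chart to another. *)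
Lemma dform_change c c' f p v : smooth_transition c c' ->
  chart_dom c p -> chart_dom c' p ->
  differentiable (f \o chart_inv c') (c' p) ->
  dform c f p v = dform c' f p (v *m jac c c' p).
Proof.
move=> st cp cp' df; rewrite /dform (grad_change st cp cp' df) !dotvE.
by rewrite trmx_mul mulmxA.
Qed.

Lemma qform_change (g : riemannian_metric M) c c' p v :
  local_coordinates c -> local_coordinates c' ->
  chart_dom c p -> chart_dom c' p ->
  qform (g c p) v = qform (g c' p) (v *m jac c c' p).
Proof.
move=> lc lc' cp cp'; rewrite /qform !bformE trmx_mul !mulmxA.
congr ((_ *m _) _ _); rewrite -!mulmxA; congr (_ *m _).
apply/matrixP => a b; rewrite (metric_tensorial g lc lc' cp cp') mulmxA.
rewrite !mxE exchange_big /=; apply: eq_bigr => j _.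
rewrite !mxE mulr_suml; apply: eq_bigr => i _; rewrite !mxE.
by rewrite [g c' p i j * _]mulrC.
Qed.

End transitions.

(** * Extension by zero of functions compactly supported in a chart *)

Section extension_by_zero.
Variables (R : realType) (m : nat) (M : smooth_manifold R m).
Implicit Types (c : chart R M m) (f : M -> R) (p : M) (v : 'rV[R]_m).
Implicit Types (F : 'rV[R]_m -> R) (L : set 'rV[R]_m).

Lemma atlas_local c : atlas c -> local_coordinates c.
Proof. by move=> ac c' ac'; exact: atlas_compatible. Qed.

Definition extend0 c F p : R := if pselect (chart_dom c p) then F (c p) else 0.

Lemma extend0_img c F x : chart_img c x -> extend0 c F (chart_inv c x) = F x.
Proof.
by move=> /chart_invK[cx E]; rewrite /extend0; case: pselect => //= _; rewrite E.
Qed.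

(** The image of [L] in M is compact, hence closed because M is Hausdorff; [W] is its complement. *)
Lemma extend0_supp c F L p : compact L -> L `<=` chart_img c ->
  (forall x, ~ L x -> F x = 0) -> ~ chart_dom c p ->
  exists2 W, open_nbhs p W & forall q, W q -> extend0 c F q = 0.
Proof.
move=> cL LU F0 ncp; exists (~` (chart_inv c @` L)).
  split; last by move=> [x /LU/chart_invK[cx _] xp]; apply: ncp; rewrite -xp.
  apply: closed_openC; apply: compact_closed; first exact: manifold_hausdorff.
  apply: continuous_compact => //; apply: continuous_in_subspaceT => x.
  by move=> /set_mem/LU; exact: chart_inv_cts.
move=> q nq; rewrite /extend0; case: pselect => //= cq; apply: F0 => Lq.
by apply: nq; exists (c q) => //; exact: chart_mapK.
Qed.

Lemma dform_extend0 c F p v : C1 F -> chart_dom c p ->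
  dform c (extend0 c F) p v = 'D_v F (c p).
Proof.
move=> CF cp; rewrite (derive_sum_basis _ (CF.1 _)).
apply: eq_bigr => a _; rewrite mxE mulrC; congr (_ * _).
apply: near_eq_derive; apply: (@near_open _ _ (chart_img c)).
- exact: chart_img_open.
- by exists p.
- by move=> y cy; exact: extend0_img.
Qed.

Lemma extend0_near0 c c1 F L p : compact L -> L `<=` chart_img c ->
  (forall x, ~ L x -> F x = 0) -> ~ chart_dom c p -> chart_dom c1 p ->
  \forall y \near c1 p, extend0 c F (chart_inv c1 y) = 0.
Proof.
move=> cL LU F0 ncp cp; have [W oW W0] := extend0_supp cL LU F0 ncp.
have ic : chart_img c1 (c1 p) by exists p.
have : \forall y \near c1 p, W (chart_inv c1 y).
  by apply: (chart_inv_cts ic); rewrite chart_mapK//; exact: open_nbhs_nbhs.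
by apply: filterS => y; exact: W0.
Qed.

Lemma dform_extend0_out c c1 F L p v : compact L -> L `<=` chart_img c ->
  (forall x, ~ L x -> F x = 0) -> ~ chart_dom c p -> chart_dom c1 p ->
  dform c1 (extend0 c F) p v = 0.
Proof.
move=> cL LU F0 ncp cp; have n0 := extend0_near0 cL LU F0 ncp cp.
rewrite /dform /dotv big1// => a _; rewrite mxE.
rewrite [pderive _ _ _ _](_ : _ = 0) ?mul0r//.
rewrite -(derive_cst (0 : R) (c1 p) (basis_vec R a)).
exact: near_eq_derive.
Qed.

(** Outside the domain of c the function is locally zero; inside, it is [F] after a transition map,
    and the chain rule gives continuous partial derivatives. *)
Lemma mC1_extend0 c F L : atlas c -> C1 F -> compact L -> L `<=` chart_img c ->
  (forall x, ~ L x -> F x = 0) -> mC1 (extend0 c F).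
Proof.
move=> ac CF cL LU F0 c1 lc1 x cx.
have [cp xE] := chart_invK cx; set p := chart_inv c1 x in cp xE *.
have [cp'|ncp] := pselect (chart_dom c p); last first.
  have n0 : \forall y \near x, extend0 c F (chart_inv c1 y) = 0.
    by rewrite -xE; exact: extend0_near0 cL LU F0 ncp cp.
  move: n0; rewrite /prop_near1 nbhsE => -[W [oW Wx] W0].
  apply: (@C1_at_open _ _ W _ (cst 0)) => // a.
  have -> : 'D_(basis_vec R a) (cst 0 : 'rV[R]_m -> R) = cst 0.
    by apply/funext => y; rewrite derive_cst.
  exact: cst_continuous.
have [st _] := lc1 _ ac.
have ox : overlap c1 c x by apply/overlapP.
pose T := c \o chart_inv c1.
apply: (@C1_at_open _ _ (overlap c1 c) _ (F \o T)) => //.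
- exact: overlap_open.
- move=> y /overlapP[cy cy'] /=; rewrite /extend0; case: pselect => //.
- move=> y a oy; apply: diff_derivable; apply: differentiable_comp.
    exact: transition_differentiable.
  exact: CF.1.
- move=> a.
  have E y : overlap c1 c y -> \sum_i 'D_(basis_vec R a) (fun z => T z ord0 i) y *
      'D_(basis_vec R i) F (T y) = 'D_(basis_vec R a) (F \o T) y.
    move=> oy; rewrite derive_chain//; last exact: CF.1.
    exact: transition_differentiable.
  apply: continuous_near_eq.
    exact: (near_open (@overlap_open _ _ _ c1 c) ox E).
  apply: (@cvg_sumr _ _ _ (nbhs x)) => i _; apply: (@cvgM _ _ (nbhs x)).
    exact: (transition_C1 i st ox).2.
  apply: (@continuous_comp _ _ _ T ('D_(basis_vec R i) F)); last exact: CF.2.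
  apply: differentiable_continuous; exact: transition_differentiable.
Qed.

End extension_by_zero.

(** * Isometric embedding into l^2 *)

Section manifold_step.
Variables (R : realType) (m : nat) (M : smooth_manifold R m).
Variable g : riemannian_metric M.
Implicit Types (c : chart R M m) (f : M -> R) (p : M) (v : 'rV[R]_m).
Implicit Types (fs gs : seq (M -> R)).

Definition msqdiff fs c p v : R := \sum_(f <- fs) dform c f p v ^+ 2.

(** Shortness in the sense of Nash. The strict inequality keeps the remainder positive definite, so
    that the next step can start. *)
Definition short fs := forall c p v, local_coordinates c -> chart_dom c p ->
  v != 0 -> msqdiff fs c p v < qform (g c p) v.

Lemma mC1_differentiable f c p : mC1 f -> local_coordinates c ->
  chart_dom c p -> differentiable (f \o chart_inv c) (c p).
Proof. by move=> Cf lc cp; apply: (Cf _ lc _ _).1; exists p. Qed.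

Lemma msqdiff_change fs c c' p v : (forall f, f \in fs -> mC1 f) ->
  local_coordinates c -> atlas c' -> chart_dom c p -> chart_dom c' p ->
  msqdiff fs c p v = msqdiff fs c' p (v *m jac c c' p).
Proof.
move=> Cfs lc ac' cp cp'; apply: eq_big_seq => f ffs; congr (_ ^+ 2).
apply: dform_change => //; first by have [] := lc _ ac'.
by apply: mC1_differentiable => //; [exact: Cfs|exact: atlas_local].
Qed.

Lemma qform_subsquares (A : 'M[R]_m) (I : Type) (r : seq I)
    (w : I -> 'rV[R]_m) v :
  qform (A - \sum_(i <- r) (w i)^T *m w i) v =
  qform A v - \sum_(i <- r) dotv (w i) v ^+ 2.
Proof.
elim: r A => [|i r IH] A; first by rewrite !big_nil !subr0.
rewrite !big_cons opprD addrA IH qformB -[(w i)^T *m _]scale1r qform_dotv mul1r.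
by rewrite opprD addrA.
Qed.

Lemma metric_posdefP c p : local_coordinates c -> chart_dom c p ->
  posdef (g c p).
Proof.
move=> lc cp; split; first exact: (Defs.metric_sym g).
by move=> v v0; exact: (metric_posdef g).
Qed.

(** [euclidean_step] is applied to the remainder [H] read in c, and its functions are extended by
    zero. Shortness is carried from c to the other charts; off the domain of c the new functions
    contribute nothing. *)
Lemma manifold_step fs c (K : set 'rV[R]_m) :
  (forall f, f \in fs -> mC1 f) -> short fs ->
  atlas c -> compact K -> K `<=` chart_img c ->
  exists gs, [/\ forall f, f \in gs -> mC1 f, short (fs ++ gs) &
    forall p v, chart_dom c p -> K (c p) ->
      step_rate R * (qform (g c p) v - msqdiff fs c p v) <= msqdiff gs c p v].
Proof.
move=> Cfs sfs ac cK KU; have lc := atlas_local ac.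
pose rep f := f \o chart_inv c.
pose H x : 'M[R]_m := \matrix_(a, b) (g c (chart_inv c x) a b -
  \sum_(f <- fs) 'D_(basis_vec R a) (rep f) x * 'D_(basis_vec R b) (rep f) x).
have HE x : chart_img c x -> H x =
    g c (chart_inv c x) - \sum_(f <- fs) (grad c f (chart_inv c x))^T *m
      grad c f (chart_inv c x).
  move=> /chart_invK[_ xE]; apply/matrixP => a b; rewrite !mxE summxE.
  congr (_ - _); apply: eq_bigr => f _.
  by rewrite mxE big_ord1 !mxE /pderive xE.
have qH x v : chart_img c x -> qform (H x) v =
    qform (g c (chart_inv c x)) v - msqdiff fs c (chart_inv c x) v.
  by move=> cx; rewrite HE// qform_subsquares.
have Hpos x : chart_img c x -> posdef (H x).
  move=> cx; have [cp _] := chart_invK cx; split; last first.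
    by move=> v v0; rewrite qH// subr_gt0; exact: sfs.
  apply/matrixP => a b; rewrite !mxE; congr (_ - _).
    by rewrite -[in LHS](Defs.metric_sym g lc cp) mxE.
  by apply: eq_bigr => f _; rewrite mulrC.
have Hcont a b x : chart_img c x -> {for x, continuous (fun y => H y a b)}.
  (* The redundant condition [f \in fs] makes the C^1 hypothesis available for each term of the
     sum. *)
  move=> cx; pose G y := g c (chart_inv c y) a b - \sum_(f <- fs | f \in fs)
    'D_(basis_vec R a) (rep f) y * 'D_(basis_vec R b) (rep f) y.
  have GE y : H y a b = G y by rewrite mxE big_seq.
  change ((fun y => H y a b) @ x --> H x a b).
  rewrite GE (_ : (fun y => H y a b) = G); last exact/funext.
  apply: (@cvgB _ _ _ (nbhs x)).
    have := metric_smooth g lc a b 0; rewrite /= continuous_open_subspace.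
      by apply; exact: mem_set.
    exact: chart_img_open.
  apply: (@cvg_sumr _ _ _ (nbhs x)) => f ffs; apply: (@cvgM _ _ (nbhs x)).
    exact: (Cfs f ffs c lc x cx).2.
  exact: (Cfs f ffs c lc x cx).2.
have oU : open (chart_img c) by exact: chart_img_open.
have [Fs [L [cL LU CF FL [Flt Fge]]]] := euclidean_step Hpos Hcont oU cK KU.
pose gs := [seq extend0 c F | F <- Fs].
have gsE p v : chart_dom c p -> msqdiff gs c p v = sqdiff Fs (c p) v.
  move=> cp; rewrite /msqdiff big_map; apply: eq_big_seq => F FFs.
  by rewrite dform_extend0//; exact: CF.
have Cgs f : f \in gs -> mC1 f.
  move=> /mapP[F FFs ->]; apply: (@mC1_extend0 _ _ _ c F L) => //; first exact: CF.
  by move=> x; exact: FL.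
exists gs; split => //; last first.
  move=> p v cp Kp; rewrite gsE//; have := Fge _ v Kp.
  by rewrite qH ?chart_mapK//; exists p.
move=> c1 p v lc1 c1p v0; rewrite /msqdiff big_cat /= -!/(msqdiff _ _ _ _).
have [cp|ncp] := pselect (chart_dom c p).
  have Q1 := (metric_posdefP lc1 c1p).2 _ v0.
  rewrite (msqdiff_change _ Cfs lc1 ac c1p cp) (msqdiff_change _ Cgs lc1 ac c1p cp).
  rewrite (qform_change g v lc1 lc c1p cp) in Q1 *.
  set u := v *m _ in Q1 *.
  (* The transported form is positive at [u], so [u] is nonzero; this avoids inverting the
     Jacobian. *)
  have u0 : u != 0.
    by apply: contraL Q1 => /eqP ->; rewrite /qform bformE !mul0mx mxE ltxx.
  rewrite gsE// -ltrBrDl; have ic : chart_img c (c p) by exists p.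
  by have := Flt _ _ ic u0; rewrite qH// chart_mapK.
rewrite [X in _ + X]big1_seq ?addr0; first exact: sfs.
move=> f /= /mapP[F FFs ->].
rewrite (@dform_extend0_out _ _ _ c c1 F L) ?expr0n// => x; exact: FL.
Qed.

End manifold_step.

(** * A countable cover by compact pieces of charts *)

Section exhaustion.
Variables (R : realType) (m : nat) (M : smooth_manifold R m).
Implicit Types (c : chart R M m) (p : M) (K : set 'rV[R]_m).

Lemma chart_compact_nbhs c p : chart_dom c p -> exists K,
  [/\ compact K, K `<=` chart_img c &
    \forall q \near p, chart_dom c q /\ K (c q)].
Proof.
move=> cp; have /nbhs_ballP[e /= e0 ball_img] := chart_img_nbhs cp.
exists [set y | sqdist (c p) y <= (e / 2) ^+ 2]; split.
- exact: sqdist_ball_compact.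
- move=> y /= ye; apply: ball_img; split => // i a.
  rewrite ord1 /ball /= distrC.
  have := le_trans (sqdist_coord (c p) y a) ye.
  rewrite -[leLHS]real_normK ?num_real// ler_sqr ?nnegrE ?divr_ge0 ?(ltW e0)//.
  by move=> /le_lt_trans; apply; rewrite ltr_pdivrMr// ltr_pMr// ltr1n.
- have n1 : nbhs p (chart_dom c).
    by apply: open_nbhs_nbhs; split => //; exact: chart_dom_open.
  have cc : {for p, continuous c}.
    have := @chart_map_continuous _ _ _ c.
    rewrite continuous_open_subspace; last exact: chart_dom_open.
    by apply; exact: mem_set.
  have n2 : nbhs (c p) [set y | sqdist (c p) y < (e / 2) ^+ 2].
    apply: open_nbhs_nbhs; split; last first.
      by rewrite /= sqdistxx exprn_gt0// divr_gt0.
    apply: (@open_comp _ _ (sqdist (c p)) [set t | t < (e / 2) ^+ 2]).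
      by move=> x _; exact: (C1_continuous (C1_sqdist (c p))).
    exact: open_lt.
  by apply: filterS2 n1 (cc _ n2) => q cq /= /ltW.
Qed.

(** For each member of a countable base that fits into a compact piece of a chart, one such piece is
    chosen and numbered by the injection of the base into nat. Numbers without a piece get the empty
    set in a chart at [p0]. *)
Lemma countable_chart_cover (p0 : M) :
  exists (c : nat -> chart R M m) (K : nat -> set 'rV[R]_m),
    (forall n, [/\ atlas (c n), compact (K n) & K n `<=` chart_img (c n)]) /\
    forall p, exists n, chart_dom (c n) p /\ K n (c n p).
Proof.
have [B /countable_injP[f finj] [Bo Bb]] := manifold_second_countable M.
have [c0 ac0 _] := atlas_cover p0.
pose adm (cK : chart R M m * set 'rV[R]_m) :=
  [/\ atlas cK.1, compact cK.2 & cK.2 `<=` chart_img cK.1].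
pose Q n cK := adm cK /\ exists U, [/\ B U, f U = n &
  forall q, U q -> chart_dom cK.1 q /\ cK.2 (cK.1 q)].
pose s n := if pselect (exists cK, Q n cK) is left e then projT1 (cid e)
  else (c0, set0).
have sP n cK : Q n cK -> Q n (s n).
  move=> QcK; rewrite /s; case: pselect => [e|[]]; last by exists cK.
  by case: cid.
exists (fun n => (s n).1), (fun n => (s n).2); split.
  move=> n; rewrite /s; case: pselect => [e|_]; first by case: cid => cK [].
  by split => //=; exact: compact0.
move=> p; have [c ac cp] := atlas_cover p.
have [K [cK KU nK]] := chart_compact_nbhs cp.
have [U [BU Up] UK] := Bb p _ nK.
have : Q (f U) (c, K) by split => //; exists U; split.
move=> /sP[_ [U' [BU' fU' U'q]]]; exists (f U); apply: U'q.
by rewrite (finj U' U (mem_set BU') (mem_set BU) fU').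
Qed.

End exhaustion.

(** * Iteration of the step and convergence to g *)

Section isometric_embedding.
Variables (R : realType) (m : nat) (M : smooth_manifold R m).
Variable g : riemannian_metric M.
Implicit Types (c : chart R M m) (f : M -> R) (p : M) (v : 'rV[R]_m).
Implicit Types (fs gs : seq (M -> R)).

Lemma mC1_cst k : mC1 (cst k : M -> R).
Proof.
move=> c _ x cx; split; first exact: differentiable_cst.
move=> a; have -> : 'D_(basis_vec R a) (cst k \o chart_inv c) = cst 0.
  by apply/funext => y; rewrite [_ \o _](_ : _ = cst k)// derive_cst.
exact: cst_continuous.
Qed.

Lemma dform_cst k c p v : dform c (cst k) p v = 0.
Proof.
rewrite /dform /dotv big1// => a _; rewrite mxE /pderive.
by rewrite [_ \o _](_ : _ = cst k)// derive_cst mul0r.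
Qed.

(** The separator [cst 0] makes every stage strictly longer than the previous one, even if a step
    adds no function, so the limit is an infinite sequence. *)
Lemma msqdiff_cat0 fs gs c p v : msqdiff (fs ++ cst 0 :: gs) c p v =
  msqdiff fs c p v + msqdiff gs c p v.
Proof. by rewrite /msqdiff big_cat /= big_cons dform_cst expr0n add0r. Qed.

Lemma short0 : short g [::].
Proof.
by move=> c p v lc cp v0; rewrite /msqdiff big_nil; exact: (metric_posdefP g lc cp).2.
Qed.

Lemma short_ge0 fs c p v : short g fs -> local_coordinates c -> chart_dom c p ->
  msqdiff fs c p v <= qform (g c p) v.
Proof.
move=> sfs lc cp; have [->|v0] := eqVneq v 0; last exact/ltW/sfs.
rewrite /qform bformE !mul0mx mxE /msqdiff big1// => f _.
by rewrite /dform dotvE trmx0 mulmx0 mxE expr0n.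
Qed.

Lemma step_rate_gt0 : 0 < step_rate R.
Proof.
have c1 : cos 4^-1 < 1 :> R.
  have pi2 := pi_ge2 R.
  rewrite -[ltRHS]cos0 ltr_cos ?in_itv/= ?invr_gt0//; apply/andP; split; lra.
have c0 : 0 <= cos 4^-1 :> R.
  have pi2 := pi_ge2 R.
  by apply: cos_ge0_pihalf; apply/andP; split; lra.
by rewrite divr_gt0// subr_gt0 expr_lt1.
Qed.

Lemma step_rate_le1 : step_rate R <= 1.
Proof. by rewrite /step_rate; have := sqr_ge0 (cos 4^-1 : R); lra. Qed.

Section iteration.
Variables (cs : nat -> chart R M m) (Ks : nat -> set 'rV[R]_m).
Hypothesis csP : forall n,
  [/\ atlas (cs n), compact (Ks n) & Ks n `<=` chart_img (cs n)].

Definition shortC1 fs := (forall f, f \in fs -> mC1 f) /\ short g fs.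

Definition short_family := {fs | shortC1 fs}.

Lemma next_exists (i : nat) (F : short_family) : exists F' : short_family,
  exists2 gs, sval F' = sval F ++ cst 0 :: gs &
    forall p v, chart_dom (cs i) p -> Ks i (cs i p) ->
      step_rate R * (qform (g (cs i) p) v - msqdiff (sval F) (cs i) p v) <=
      msqdiff gs (cs i) p v.
Proof.
case: F => fs [Cfs sfs] /=; have [ac cK KU] := csP i.
have [gs [Cgs sgs gsP]] := manifold_step Cfs sfs ac cK KU.
suff H : shortC1 (fs ++ cst 0 :: gs) by exists (exist shortC1 _ H), gs.
split=> [f|c p v lc cp v0].
  by rewrite mem_cat inE => /or3P[/Cfs|/eqP->|/Cgs]//; exact: mC1_cst.
have := sgs c p v lc cp v0.
by rewrite msqdiff_cat0 /msqdiff big_cat.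
Qed.

(* The exponent of 2 in [n.+1] takes each value infinitely often. *)
Definition visit n := logn 2 n.+1.

Lemma visit_later i n : exists2 n', (n <= n')%N & visit n' = i.
Proof.
(* The successor of this number is 2^i times an odd number, and it exceeds n. *)
exists (2 ^ i * n.*2.+1).-1.
  have : (n.*2.+1 <= 2 ^ i * n.*2.+1)%N by rewrite leq_pmull// expn_gt0.
  by rewrite -addnn; lia.
have e0 : (0 < 2 ^ i * n.*2.+1)%N by rewrite muln_gt0 expn_gt0.
rewrite /visit prednK// lognM ?expn_gt0// pfactorK// logn_coprime ?addn0//.
by rewrite coprime2n /= odd_double.
Qed.

Lemma shortC1_nil : shortC1 [::].
Proof. by split => //; exact: short0. Qed.

Fixpoint stage n : short_family :=
  if n is n'.+1 then projT1 (cid (next_exists (visit n') (stage n')))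
  else exist shortC1 [::] shortC1_nil.

Lemma stageS n : exists2 gs, sval (stage n.+1) = sval (stage n) ++ cst 0 :: gs &
  forall p v, chart_dom (cs (visit n)) p -> Ks (visit n) (cs (visit n) p) ->
    step_rate R *
      (qform (g (cs (visit n)) p) v - msqdiff (sval (stage n)) (cs (visit n)) p v)
    <= msqdiff gs (cs (visit n)) p v.
Proof. by rewrite /=; case: cid. Qed.

Lemma stage_size n : (n <= size (sval (stage n)))%N.
Proof.
elim: n => // n IH; have [gs -> _] := stageS n.
by rewrite size_cat /=; lia.
Qed.

Lemma stage_prefix n n' : (n <= n')%N ->
  exists gs, sval (stage n') = sval (stage n) ++ gs.
Proof.
move=> /subnKC <-; elim: (n' - n)%N => [|k [gs IH]].
  by exists [::]; rewrite addn0 cats0.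
rewrite addnS; have [hs -> _] := stageS (n + k).
by rewrite IH -catA; eexists.
Qed.

Definition component k : M -> R := nth (cst 0) (sval (stage k.+1)) k.

Lemma stage_nth n k : (k < size (sval (stage n)))%N ->
  nth (cst 0) (sval (stage n)) k = component k.
Proof.
move=> kn; rewrite /component; have [nk|kn'] := leqP n k.+1.
  by have [gs ->] := stage_prefix nk; rewrite nth_cat kn.
by have [gs ->] := stage_prefix (ltnW kn'); rewrite nth_cat stage_size.
Qed.

Lemma component_mC1 k : mC1 (component k).
Proof.
apply: (svalP (stage k.+1)).1; apply: mem_nth; exact: stage_size.
Qed.

Lemma msqdiff_stage n c p v : msqdiff (sval (stage n)) c p v =
  \sum_(0 <= k < size (sval (stage n))) dform c (component k) p v ^+ 2.
Proof.
rewrite /msqdiff (big_nth (cst 0)); apply: eq_big_nat => k /andP[_ kn].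
by rewrite stage_nth.
Qed.

Lemma psum_nd c p v n n' : (n <= n')%N ->
  \sum_(0 <= k < n) dform c (component k) p v ^+ 2 <=
  \sum_(0 <= k < n') dform c (component k) p v ^+ 2.
Proof.
move=> nn'; rewrite [leRHS](big_cat_nat (leq0n n) nn')/= lerDl.
by apply: sumr_ge0 => k _; exact: sqr_ge0.
Qed.

Lemma msqdiff_stage_nd c p v n n' : (n <= n')%N ->
  msqdiff (sval (stage n)) c p v <= msqdiff (sval (stage n')) c p v.
Proof.
move=> /stage_prefix[gs ->]; rewrite /msqdiff big_cat /= lerDl.
by apply: sumr_ge0 => k _; exact: sqr_ge0.
Qed.

(** Each visit to the i-th piece multiplies the remainder by at most 1 - d, it never grows in
    between, and there are infinitely many visits. *)
Lemma residual_geometric i p v N :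
  chart_dom (cs i) p -> Ks i (cs i p) ->
  exists n, qform (g (cs i) p) v - msqdiff (sval (stage n)) (cs i) p v <=
    (1 - step_rate R) ^+ N * qform (g (cs i) p) v.
Proof.
move=> cp Kp; elim: N => [|N [n IH]].
  by exists 0%N; rewrite expr0 mul1r /msqdiff big_nil subr0.
have [n' nn' vn'] := visit_later i n; exists n'.+1.
have [gs -> ] := stageS n'; rewrite vn' => /(_ p v cp Kp).
rewrite msqdiff_cat0 => gsP.
have nd := msqdiff_stage_nd (cs i) p v nn'.
have r0 := step_rate_gt0; have r1 := step_rate_le1.
have IH' : qform (g (cs i) p) v - msqdiff (sval (stage n')) (cs i) p v <=
    (1 - step_rate R) ^+ N * qform (g (cs i) p) v by lra.
have r2 : 0 <= 1 - step_rate R by lra.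
have := ler_wpM2l r2 IH'; rewrite exprS -mulrA; lra.
Qed.

(** The partial sums increase and stay below [q] by shortness; a late enough stage comes within e of
    [q], and so do all longer sums. *)
Lemma component_isometric i p v : chart_dom (cs i) p -> Ks i (cs i p) ->
  \sum_(0 <= k < n) dform (cs i) (component k) p v ^+ 2 @[n --> \oo] -->
  qform (g (cs i) p) v.
Proof.
move=> cp Kp; set q := qform _ _; have [ac _ _] := csP i.
have lc := atlas_local ac.
have up n : \sum_(0 <= k < n) dform (cs i) (component k) p v ^+ 2 <= q.
  apply: le_trans (psum_nd _ _ _ (stage_size n)) _.
  by rewrite -msqdiff_stage; apply: short_ge0 => //; exact: (svalP (stage n)).2.
apply/cvgrPdist_le => e e0.
have r0 := step_rate_gt0; have r1 := step_rate_le1.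
have : \forall N \near \oo, (1 - step_rate R) ^+ N * q <= e.
  have cv : (1 - step_rate R) ^+ N * q @[N --> \oo] --> 0 * q.
    apply: cvgM; last exact: cvg_cst.
    by apply: cvg_expr; rewrite ger0_norm; lra.
  rewrite mul0r in cv; have /cvgrPdistC_le/(_ _ e0) := cv.
  by apply: filterS => N; rewrite subr0; exact: le_trans (ler_norm _).
move=> [N0 _ /(_ N0 (leqnn _))] /= qe.
have [n nE] := residual_geometric v N0 cp Kp.
near=> k; rewrite ger0_norm ?subr_ge0//.
apply: le_trans qe; apply: le_trans nE; rewrite lerD2l lerN2 msqdiff_stage.
by apply: psum_nd; near: k; exact: nbhs_infty_ge.
Unshelve. all: by end_near. Qed.

End iteration.

Lemma isometric_l2 : exists f : nat -> M -> R, (forall k, mC1 (f k)) /\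
  forall c p v, local_coordinates c -> chart_dom c p ->
    \sum_(0 <= k < n) dform c (f k) p v ^+ 2 @[n --> \oo] --> qform (g c p) v.
Proof.
(* The cover needs a point for its default chart; on an empty manifold any sequence will do. *)
have [[p0 _]|M0] := pselect (exists p : M, True); last first.
  exists (fun=> cst 0); split => [k|c p]; first exact: mC1_cst.
  by case: M0; exists p.
have [cs [Ks [csP cov]]] := countable_chart_cover p0.
exists (component csP); split => [k|c p v lc cp]; first exact: component_mC1.
have [i [cip Kip]] := cov p; have [ac _ _] := csP i.
rewrite (qform_change g v lc (atlas_local ac) cp cip).
have E k : dform c (component csP k) p v =
    dform (cs i) (component csP k) p (v *m jac c (cs i) p).
  apply: dform_change => //; first by have [] := lc _ ac.
  by apply: mC1_differentiable cip; [exact: component_mC1|exact: atlas_local].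
rewrite (_ : (fun n => _) = fun n => \sum_(0 <= k < n)
    dform (cs i) (component csP k) p (v *m jac c (cs i) p) ^+ 2).
  exact: (component_isometric csP).
by apply/funext => n; apply: eq_bigr => k _; rewrite E.
Qed.

End isometric_embedding.

(** * Densities on the line *)

Section bumps_on_the_line.
Variable R : realType.
Implicit Types (B : nat -> R -> R) (x y a b : R) (k n : nat).

(** For x < 0 this is the index of a cell that does not contain x, where the pieces of a family
    satisfying [in_cells] vanish. *)
Definition cell_index x : nat := `|Num.floor x|%N.

Definition assemble B x : R := B (cell_index x) x.

Definition in_cells B :=
  forall k x, ~~ (k%:R < x < k%:R + 1) -> B k x = 0.

Lemma in_cells_out B k x : in_cells B -> k != cell_index x -> B k x = 0.
Proof.
move=> cB kx; apply: cB; apply: contra kx => /andP[kx xk].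
have fx : Num.floor x = k%:Z.
  by apply: floor_def; rewrite intrD -!pmulrn (ltW kx) xk.
by rewrite /cell_index fx.
Qed.

(** On a half-line bounded above only finitely many cells matter, which reduces continuity and
    integration to finite sums. *)
Lemma assemble_sum B x n : in_cells B -> x < n%:R ->
  assemble B x = \sum_(k < n) B k x.
Proof.
move=> cB xn; rewrite /assemble; have [Kn|nK] := ltnP (cell_index x) n.
  rewrite (bigD1 (Ordinal Kn))//= big1 ?addr0// => k kK.
  by apply: in_cells_out => //; apply: contra kK => /eqP kK; apply/eqP/val_inj.
rewrite big1 => [|k _]; last first.
  by apply: in_cells_out => //; rewrite ltn_eqF// (leq_trans (ltn_ord k)).
apply: cB; apply/negP => /andP[Kx _].
by have := lt_trans Kx xn; rewrite ltr_nat ltnNge nK.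
Qed.

Lemma assemble_continuous B : in_cells B -> (forall k, continuous (B k)) ->
  continuous (assemble B).
Proof.
move=> cB ctB x; pose n := (Num.truncn x).+1.
have xn : x < n%:R by rewrite /n; exact: truncnS_gt.
pose G y := \sum_(k < n) B k y.
have cG : G y @[y --> x] --> G x.
  by apply: (@cvg_sumr _ _ _ (nbhs x)) => k _; exact: ctB.
rewrite /continuous_at (assemble_sum cB xn); apply: cvg_trans cG.
apply: near_eq_cvg; near=> y.
rewrite /G -assemble_sum//; near: y; exact: lt_nbhsl.
Unshelve. all: by end_near. Qed.

(** The series of the pieces is eventually constant at each point, and its nonnegative terms may be
    integrated one by one. *)
Lemma integral_assemble B (l : nat -> R) (L : R) : in_cells B ->
  (forall k, continuous (B k)) -> (forall k x, 0 <= B k x) ->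
  (forall k, \int[@lebesgue_measure R]_(x in setT) (B k x)%:E = (l k)%:E)%E ->
  (\sum_(0 <= k < n) l k @[n --> \oo] --> L) ->
  (\int[@lebesgue_measure R]_(x in setT) (assemble B x)%:E = L%:E)%E.
Proof.
move=> cB ctB B0 Bl lL.
have gE x : (assemble B x)%:E = (\sum_(0 <= k <oo) (B k x)%:E)%E.
  apply/esym/lim_near_cst => //; near=> n.
  rewrite sumEFin big_mkord -assemble_sum//.
  apply: lt_le_trans (truncnS_gt x) _; rewrite ler_nat; near: n.
  exact: nbhs_infty_ge.
under eq_integral do rewrite gE.
rewrite integral_nneseries//; last 2 first.
- move=> k; apply/measurable_EFinP; exact: continuous_measurable_fun.
- by move=> k x _; rewrite lee_fin.
under eq_eseriesr do rewrite Bl.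
apply/cvg_lim => //; under eq_fun do rewrite sumEFin.
by apply: cvg_EFin lL; exact: nearW.
Unshelve. all: by end_near. Qed.

(* The factors [sqrt 30] and [sqrt 210] make [y(1-y)] and [y(1-y)(2y-1)]
   orthonormal in L^2(]0,1[). *)
Definition wave a b y : R := Num.max 0 (y * (1 - y)) *
  (Num.sqrt 30 * a + Num.sqrt 210 * b * (2 * y - 1)).

Definition septic (u v w z r : R) : {poly R} :=
  u *: 'X^3 + v *: 'X^4 + w *: 'X^5 + z *: 'X^6 + r *: 'X^7.

Lemma septic_horner u v w z r y : (septic u v w z r).[y] =
  u * y ^+ 3 + v * y ^+ 4 + w * y ^+ 5 + z * y ^+ 6 + r * y ^+ 7.
Proof. by rewrite /septic !hornerD !hornerZ !hornerXn. Qed.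

Lemma septic_deriv u v w z r y : (septic u v w z r)^`().[y] =
  3 * u * y ^+ 2 + 4 * v * y ^+ 3 + 5 * w * y ^+ 4 + 6 * z * y ^+ 5
  + 7 * r * y ^+ 6.
Proof.
rewrite /septic !derivD !derivZ !derivXn !hornerD !hornerZ !hornerMn.
by rewrite !hornerXn /=; ring.
Qed.

(** The antiderivative of y^2 (1 - y)^2 (A + B (2y - 1) + C (2y - 1)^2), which is the square of the
    wave on [0, 1]. *)
Definition wave_prim a b : {poly R} :=
  let A := 30 * a ^+ 2 in
  let B := 2 * (Num.sqrt 30 * Num.sqrt 210) * a * b in
  let C := 210 * b ^+ 2 in
  septic ((A - B + C) / 3) (- A / 2 + B - C * (3 / 2))
    (A / 5 - B + C * (13 / 5)) (B / 3 - C * 2) (C * (4 / 7)).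

Lemma wave_prim_deriv a b y : 0 <= y <= 1 ->
  (wave_prim a b)^`().[y] = wave a b y ^+ 2.
Proof.
move=> /andP[y0 y1]; rewrite /wave max_r; last by rewrite mulr_ge0// subr_ge0.
rewrite /wave_prim septic_deriv.
have s30 : Num.sqrt 30 ^+ 2 = 30 :> R by rewrite sqr_sqrtr// ler0n.
have s210 : Num.sqrt 210 ^+ 2 = 210 :> R by rewrite sqr_sqrtr// ler0n.
set s := Num.sqrt 30 in s30 *; set t := Num.sqrt 210 in s210 *.
by rewrite -s30 -s210; field.
Qed.

Lemma wave_prim_increment a b :
  (wave_prim a b).[1] - (wave_prim a b).[0] = a ^+ 2 + b ^+ 2.
Proof. by rewrite /wave_prim !septic_horner !expr1n !expr0n /=; field. Qed.

Lemma wave_out a b y : ~~ (0 < y < 1) -> wave a b y = 0.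
Proof.
move=> y01; rewrite /wave max_l ?mul0r//; rewrite negb_and -!leNgt in y01.
by case/orP: y01 => y01; nra.
Qed.

Lemma wave_continuous a b : continuous (wave a b).
Proof.
move=> y; apply: (@continuousM _ _ (fun y => Num.max 0 (y * (1 - y)))).
  apply: continuous_max; first exact: cst_continuous.
  apply: continuousM; first exact: cvg_id.
  by apply: continuousB; [exact: cst_continuous|exact: cvg_id].
apply: continuousD; first exact: cst_continuous.
apply: (@continuousM _ _ (cst (Num.sqrt 210 * b))); first exact: cst_continuous.
apply: continuousB; last exact: cst_continuous.
by apply: (@continuousM _ _ (cst 2)); [exact: cst_continuous|exact: cvg_id].
Qed.

Lemma wave_shift_continuous a b k : continuous (fun x => wave a b (x - k%:R)).
Proof.
move=> x; apply: (@continuous_comp _ _ _ (fun x => x - k%:R)).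
  by apply: continuousB; [exact: cvg_id|exact: cst_continuous].
exact: wave_continuous.
Qed.

Lemma integral_wave a b k :
  (\int[@lebesgue_measure R]_(x in setT) (wave a b (x - k%:R) ^+ 2)%:E =
   (a ^+ 2 + b ^+ 2)%:E)%E.
Proof.
pose F : {poly R} := wave_prim a b \Po ('X - k%:R%:P).
have dF x : F^`().[x] = (wave_prim a b)^`().[x - k%:R].
  by rewrite /F deriv_comp derivXsubC mulr1 horner_comp hornerXsubC.
transitivity (\int[@lebesgue_measure R]_(x in `[(k%:R : R)%R, (k%:R + 1 : R)%R])
    ((wave a b (x - k%:R) ^+ 2)%R)%:E)%E.
  rewrite [RHS]integral_mkcond; apply: eq_integral => x _.
  rewrite /patch; case: ifPn => // xk; rewrite wave_out ?expr0n//.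
  apply: contra xk => /andP[x0 x1]; apply: mem_set; rewrite /= in_itv /=.
  by apply/andP; split; lra.
rewrite (@continuous_FTC2 _ _ (horner F)).
- by rewrite -EFinB /F !horner_comp !hornerXsubC addrAC subrr add0r
    wave_prim_increment.
- by rewrite ltrDl.
- apply: continuous_subspaceT => x.
  apply: (@continuousM _ _ (fun x => wave a b (x - k%:R)));
    exact: wave_shift_continuous.
- split.
  + by move=> x _; exact: derivable_horner.
  + apply: cvg_at_right_filter; exact: continuous_horner.
  + apply: cvg_at_left_filter; exact: continuous_horner.
- move=> x; rewrite in_itv /= => /andP[x0 x1].
  rewrite -derive.derivE dF wave_prim_deriv//; apply/andP; split; lra.
Qed.

End bumps_on_the_line.

(** * The density and its Fisher information *)

Section fisher_family.
Variables (R : realType) (m : nat) (M : smooth_manifold R m).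
Variable g : riemannian_metric M.
Variable f : nat -> M -> R.
Hypothesis f_C1 : forall k, mC1 (f k).
Hypothesis f_iso : forall c p v, local_coordinates c -> chart_dom c p ->
  \sum_(0 <= k < n) dform c (f k) p v ^+ 2 @[n --> \oo] --> qform (g c p) v.
Implicit Types (c : chart R M m) (p : M) (x t : R) (k : nat).

Definition mass k : R := (2 ^+ k.+1)^-1.

Definition amp k : R := Num.sqrt (mass k).

(** The square root of the density moves on a circle of radius [amp k]; with this frequency its
    speed is 1/2. As Fisher information is four times the squared speed of the root, it is 1 in the
    variable t. *)
Definition freq k : R := (2 * amp k)^-1.

Lemma amp_gt0 k : 0 < amp k.
Proof. by rewrite sqrtr_gt0 invr_gt0 exprn_gt0. Qed.

Definition dens_root k t x : R :=
  wave (amp k * cos (freq k * t)) (amp k * sin (freq k * t)) (x - k%:R).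

(** The unit tangent to the circle, equal to twice the t-derivative of [dens_root]. *)
Definition dens_tangent k t x : R :=
  wave (- sin (freq k * t)) (cos (freq k * t)) (x - k%:R).

Lemma is_derive_dens k t x : is_derive t 1 (fun t => dens_root k t x ^+ 2)
  (dens_root k t x * dens_tangent k t x).
Proof.
have dl : is_derive t (1 : R) (fun t : R => freq k * t) (freq k).
  rewrite (_ : (fun t : R => freq k * t) = freq k \*: (id : R -> R))//.
  by apply: is_derive_eq; rewrite [_ *: _]mulr1.
have dc : is_derive t (1 : R) (fun t => cos (freq k * t)) (- sin (freq k * t) * freq k).
  exact: (@is_derive1_comp _ cos (fun t => freq k * t)).
have ds : is_derive t (1 : R) (fun t => sin (freq k * t)) (cos (freq k * t) * freq k).
  exact: (@is_derive1_comp _ sin (fun t => freq k * t)).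
pose w := Num.max 0 ((x - k%:R) * (1 - (x - k%:R))).
pose al := w * Num.sqrt 30 * amp k.
pose be := w * Num.sqrt 210 * amp k * (2 * (x - k%:R) - 1).
(* For fixed x the root is a linear combination of a cosine and a sine of t. *)
pose h := al \*: (fun t => cos (freq k * t)) + be \*: (fun t => sin (freq k * t)).
have hE s : dens_root k s x = h s.
  rewrite /dens_root /wave -/w /h /al /be !fctE /= /GRing.scale /=; ring.
rewrite (_ : (fun t => _) = h ^+ 2); last first.
  by apply/funext => s; rewrite hE.
apply: is_derive_eq; rewrite expr1 -hE /dens_tangent /wave -/w /al /be /freq.
have a0 : amp k != 0 by rewrite gt_eqF// amp_gt0.
rewrite /GRing.scale /=; field.
by rewrite a0.
Qed.

Definition dens x p : R := assemble (fun k x => dens_root k (f k p) x ^+ 2) x.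

Lemma dens_ge0 x p : 0 <= dens x p.
Proof. exact: sqr_ge0. Qed.

Lemma wave_cells (a b : nat -> R) :
  in_cells (fun k x => wave (a k) (b k) (x - k%:R) ^+ 2).
Proof.
move=> k x kx; rewrite wave_out ?expr0n//; apply: contra kx => /andP[h1 h2].
by apply/andP; split; lra.
Qed.

Lemma wave_sq_continuous (a b : R) k :
  continuous (fun x => wave a b (x - k%:R) ^+ 2).
Proof.
by move=> x; apply: (@continuousM _ _ (fun x => wave a b (x - k%:R)));
  exact: wave_shift_continuous.
Qed.

Lemma dens_continuous p : continuous (fun x => dens x p).
Proof.
apply: (@assemble_continuous _ (fun k x => dens_root k (f k p) x ^+ 2)).
  exact: wave_cells.
move=> k; exact: wave_sq_continuous.
Qed.

Lemma dens_integral p :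
  (\int[@lebesgue_measure R]_(x in setT) (dens x p)%:E = 1%:E)%E.
Proof.
apply: (@integral_assemble _ (fun k x => dens_root k (f k p) x ^+ 2) mass).
- exact: wave_cells.
- move=> k; exact: wave_sq_continuous.
- by move=> k x; exact: sqr_ge0.
- move=> k; rewrite integral_wave !exprMn -mulrDr cos2Dsin2 mulr1.
  by rewrite sqr_sqrtr// invr_ge0 exprn_ge0.
- have := @cvg_geometric_series_half R 1 0; rewrite expr0 divr1.
  apply: cvg_trans; apply: near_eq_cvg; apply: nearW => n.
  by rewrite /series /=; apply: eq_bigr => k _; rewrite /mass natrX addn1 mul1r.
Qed.

Lemma pderive_comp (phi : R -> R) (h : M -> R) c p a (d : R) :
  local_coordinates c -> chart_dom c p -> mC1 h -> is_derive (h p) 1 phi d ->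
  pderivable c a (phi \o h) p /\
  pderive c a (phi \o h) p = d * pderive c a h p.
Proof.
move=> lc cp Ch dphi; have hd := mC1_differentiable Ch lc cp.
rewrite -[in h p](chart_mapK cp) in dphi.
have pd : differentiable phi ((h \o chart_inv c) (c p)).
  exact: is_derive_differentiable dphi.
have hpd : differentiable (phi \o (h \o chart_inv c)) (c p).
  exact: differentiable_comp.
split; first exact: diff_derivable.
rewrite /pderive [LHS]deriveE// diff_comp//= deriv1E; last exact: ex_derive.
rewrite -deriveE// [LHS]/GRing.scale /= mulrC derive1E.
by have -> := @derive_val _ _ _ _ _ _ _ dphi.
Qed.

(** The cell of x does not depend on the parameter, so near p the density at x is a function of a
    single [f k]. *)
Lemma dens_pderive c p a x : local_coordinates c -> chart_dom c p ->
  pderivable c a (dens x) p /\ pderive c a (dens x) p =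
  assemble (fun k x => dens_root k (f k p) x * dens_tangent k (f k p) x *
    pderive c a (f k) p) x.
Proof.
move=> lc cp; exact: (pderive_comp a lc cp (f_C1 _) (is_derive_dens _ _ _)).
Qed.

Lemma dens_pdf : pdf_family [set: R] dens.
Proof.
split.
- split; [by exists 0|exact: openT|].
  by apply/connected_intervalP.
- by move=> x p _; exact: dens_ge0.
- by move=> p; apply: continuous_subspaceT; exact: dens_continuous.
- exact: dens_integral.
- by move=> c p lc cp a x _; have [] := dens_pderive a x lc cp.
- move=> c p lc cp a; apply: continuous_subspaceT.
  rewrite (_ : (fun x => _) = assemble (fun k x => dens_root k (f k p) x *
    dens_tangent k (f k p) x * pderive c a (f k) p)); last first.
    by apply/funext => x; have [_ ->] := dens_pderive a x lc cp.
  apply: assemble_continuous.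
    move=> k x kx; rewrite /dens_root wave_out ?mul0r//.
    apply: contra kx => /andP[h1 h2]; by apply/andP; split; lra.
  move=> k x; apply: (@continuousM _ _ (fun x => dens_root k (f k p) x *
    dens_tangent k (f k p) x)); last exact: cst_continuous.
  by apply: continuousM; exact: wave_shift_continuous.
Qed.

(** The Fisher integrand along v, [dens_tangent] squared times the square of df_k(v), with a
    continuous value at the zeros of the density. It is written as a squared wave so that its
    integral is known. *)
Definition fisher_square c p v x : R := assemble (fun k x =>
  wave (- sin (freq k * f k p) * dform c (f k) p v)
       (cos (freq k * f k p) * dform c (f k) p v) (x - k%:R) ^+ 2) x.

Lemma wave_scale (d a b y : R) : wave (a * d) (b * d) y = wave a b y * d.
Proof. by rewrite /wave; ring. Qed.

Lemma fisher_square_continuous c p v : continuous (fisher_square c p v).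
Proof.
apply: (@assemble_continuous _ (fun k x =>
  wave (- sin (freq k * f k p) * dform c (f k) p v)
       (cos (freq k * f k p) * dform c (f k) p v) (x - k%:R) ^+ 2)).
  exact: wave_cells.
move=> k; exact: wave_sq_continuous.
Qed.

Lemma fisher_square_integral c p v : local_coordinates c -> chart_dom c p ->
  (\int[@lebesgue_measure R]_(x in setT) (fisher_square c p v x)%:E =
   (qform (g c p) v)%:E)%E.
Proof.
move=> lc cp; apply: (@integral_assemble _ (fun k x =>
  wave (- sin (freq k * f k p) * dform c (f k) p v)
       (cos (freq k * f k p) * dform c (f k) p v) (x - k%:R) ^+ 2)
  (fun k => dform c (f k) p v ^+ 2)).
- exact: wave_cells.
- move=> k; exact: wave_sq_continuous.
- by move=> k x; exact: sqr_ge0.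
- move=> k; rewrite integral_wave !exprMn -mulrDl sqrrN addrC cos2Dsin2.
  by rewrite mul1r.
- exact: f_iso.
Qed.

Lemma fisher_square_integrable c p v : local_coordinates c -> chart_dom c p ->
  (@lebesgue_measure R).-integrable setT (EFin \o fisher_square c p v).
Proof.
move=> lc cp; apply/integrableP; split.
  apply/measurable_EFinP; apply: continuous_measurable_fun.
  exact: fisher_square_continuous.
under eq_integral => x _ do rewrite /= ger0_norm ?sqr_ge0//.
by rewrite fisher_square_integral// ltry.
Qed.

(** For polarisation: with s = 1/2 and s = -1/2, a mixed component is a difference of two values of
    the form, hence of two nonnegative integrals. *)
Definition half_vec (s : R) (a b : 'I_m) : 'rV[R]_m :=
  2^-1 *: basis_vec R a + s *: basis_vec R b.

Lemma dform_half c h p s a b : dform c h p (half_vec s a b) =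
  2^-1 * pderive c a h p + s * pderive c b h p.
Proof.
have dotvC (u v : 'rV[R]_m) : dotv u v = dotv v u.
  by apply: eq_bigr => i _; rewrite mulrC.
rewrite /dform /half_vec dotv_linear [dotv _ (s *: _)]dotvE linearZ /=.
rewrite -scalemxAr mxE -dotvE -/(GRing.scale _ _) ![dotv (grad c h p) _]dotvC.
by rewrite !dotv_delta !mxE.
Qed.

Lemma qform_half (A : 'M[R]_m) a b : A^T = A ->
  qform A (half_vec 2^-1 a b) - qform A (half_vec (- 2^-1) a b) = A a b.
Proof.
move=> sA; rewrite /half_vec !qformD//.
have -> : bform A (2^-1 *: basis_vec R a) (basis_vec R b) = 2^-1 * A a b.
  by rewrite bformE -!scalemxAl mxE -bformE bform_delta2.
by field.
Qed.

Definition fisher_integrand c p a b x : R := dens x p *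
  pderive c a (fun q => ln (dens x q)) p * pderive c b (fun q => ln (dens x q)) p.

Definition fisher_smooth c p a b x : R :=
  fisher_square c p (half_vec 2^-1 a b) x -
  fisher_square c p (half_vec (- 2^-1) a b) x.

Lemma fisher_smoothE c p a b x : fisher_smooth c p a b x =
  let k := cell_index x in
  dens_tangent k (f k p) x ^+ 2 * pderive c a (f k) p * pderive c b (f k) p.
Proof.
rewrite /fisher_smooth /fisher_square /assemble /dens_tangent !wave_scale.
by rewrite !dform_half /=; field.
Qed.

(** The logarithmic derivative is tangent over root times that of [f k]; multiplying the product of
    two of them by the squared root leaves the squared tangent. *)
Lemma fisher_integrandE c p a b x : local_coordinates c -> chart_dom c p ->
  dens x p != 0 -> fisher_integrand c p a b x = fisher_smooth c p a b x.
Proof.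
move=> lc cp d0; have dp : 0 < dens x p by rewrite lt_neqAle eq_sym d0 dens_ge0.
pose k := cell_index x; pose phi t := dens_root k t x ^+ 2.
have dphi := is_derive_dens k (f k p) x.
have dln : is_derive (f k p) 1 (@ln R \o phi) ((dens x p)^-1 *
    (dens_root k (f k p) x * dens_tangent k (f k p) x)).
  by apply: is_derive1_comp; exact: is_derive1_ln.
have lnE e : pderive c e (fun q => ln (dens x q)) p = (dens x p)^-1 *
    (dens_root k (f k p) x * dens_tangent k (f k p) x) * pderive c e (f k) p.
  by have [_ <-] := pderive_comp e lc cp (f_C1 k) dln.
rewrite fisher_smoothE /= -/k /fisher_integrand !lnE.
have dE : dens x p = dens_root k (f k p) x ^+ 2 by [].
have r0 : dens_root k (f k p) x != 0.
  by apply: contra d0 => /eqP; rewrite dE => ->; rewrite expr0n.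
by rewrite dE; field.
Qed.

(* The only point where the density may vanish inside the [k]-th cell. *)
Definition dens_zero p k : R := k%:R + 2^-1 * (1 -
  Num.sqrt 30 * cos (freq k * f k p) / (Num.sqrt 210 * sin (freq k * f k p))).

(** A nonzero tangent places x inside its cell, where the root vanishes only through its affine
    factor. *)
Lemma dens_zeroP c p a b x : dens x p = 0 -> fisher_smooth c p a b x != 0 ->
  range (dens_zero p) x.
Proof.
pose k := cell_index x => d0; rewrite fisher_smoothE /= -/k => h0.
exists k => //; have t0 : dens_tangent k (f k p) x != 0.
  by apply: contra h0 => /eqP ->; rewrite expr0n !mul0r.
have [y01 w0] : 0 < x - k%:R < 1 /\
    0 < Num.max 0 ((x - k%:R) * (1 - (x - k%:R))).
  have y01 : 0 < x - k%:R < 1.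
    by apply/negPn/negP => y01; move: t0; rewrite /dens_tangent wave_out ?eqxx.
  by split => //; case/andP: y01 => y0 y1; rewrite lt_max mulr_gt0 ?orbT// subr_gt0.
have : dens_root k (f k p) x == 0 by rewrite -sqrf_eq0; apply/eqP.
rewrite /dens_root /wave mulf_eq0 (gt_eqF w0) /=.
set C := cos _; set S := sin _ => /eqP E.
have A0 := amp_gt0 k.
have s30 : 0 < Num.sqrt 30 :> R by rewrite sqrtr_gt0.
have s210 : 0 < Num.sqrt 210 :> R by rewrite sqrtr_gt0.
have E' : Num.sqrt 30 * C + Num.sqrt 210 * S * (2 * (x - k%:R) - 1) = 0.
  by apply: (mulfI (lt0r_neq0 A0)); rewrite mulr0 -[RHS]E; ring.
(* If the sine were 0, the equation would make the cosine 0 as well. *)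
have S0 : S != 0.
  apply/negP => /eqP S0; have : C ^+ 2 + S ^+ 2 = 1 by exact: cos2Dsin2.
  move: E'; rewrite S0 mulr0 mul0r addr0 => /eqP; rewrite mulf_eq0 (gt_eqF s30) /=.
  by move=> /eqP ->; rewrite expr0n /= addr0 => /eqP; rewrite eq_sym oner_eq0.
rewrite /dens_zero -/C -/S.
have -> : Num.sqrt 30 * C = - (Num.sqrt 210 * S * (2 * (x - k%:R) - 1)).
  by apply/eqP; rewrite -addr_eq0 E'.
field.
by rewrite (gt_eqF s210) S0.
Qed.

Lemma fisher_integrand_measurable c p a b :
  local_coordinates c -> chart_dom c p ->
  measurable_fun setT (fisher_integrand c p a b).
Proof.
move=> lc cp; pose A := [set x | dens x p != 0].
have mA : measurable A.
  apply: open_measurable.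
  apply: (@open_comp _ _ (fun x => dens x p) [set t | t != 0]).
    by move=> x _; exact: dens_continuous.
  exact: open_neq.
(* The integrand is 0 where the density is, and [A] is open as the density is continuous in x. *)
have -> : fisher_integrand c p a b = fisher_smooth c p a b \* \1_A.
  apply/funext => x /=; rewrite indicE; have [xA|xA] := pselect (A x).
    by rewrite mem_set// mulr1 fisher_integrandE.
  rewrite memNset// mulr0 /fisher_integrand.
  by move: xA => /negP/negPn/eqP ->; rewrite !mul0r.
apply: measurable_funM; last exact: measurable_indic.
by apply: measurable_funB; apply: continuous_measurable_fun;
  exact: fisher_square_continuous.
Qed.

(** The integrand and its continuous version differ at most on the countable set of zeros
    [dens_zero], which is null; polarisation then gives the component of g. *)
Lemma fisher_integral c p a b : local_coordinates c -> chart_dom c p ->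
  (\int[@lebesgue_measure R]_(x in setT) (fisher_integrand c p a b x)%:E =
   (g c p a b)%:E)%E.
Proof.
move=> lc cp; transitivity
    (\int[@lebesgue_measure R]_(x in setT) (fisher_smooth c p a b x)%:E)%E.
  apply: ae_eq_integral => //.
  - by apply/measurable_EFinP; exact: fisher_integrand_measurable.
  - apply/measurable_EFinP; apply: measurable_funB;
      by apply: continuous_measurable_fun; exact: fisher_square_continuous.
  have cZ : countable (range (dens_zero p)).
    by apply: sub_countable (card_image_le _ _) _; exact: countableP.
  exists (range (dens_zero p)); split.
  - by apply: countable_measurable.
  - exact: countable_lebesgue_measure0.
  - move=> x /= nE; apply: (@dens_zeroP c p a b).
      apply: contrapT => /eqP d0; apply: nE => _.
      by rewrite fisher_integrandE.
    apply/eqP => h0; apply: nE => _; congr _%:E.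
    rewrite h0; have [d0|d0] := eqVneq (dens x p) 0.
      by rewrite /fisher_integrand d0 !mul0r.
    by rewrite fisher_integrandE.
rewrite /fisher_smooth; under eq_integral do rewrite EFinB.
rewrite integralB_EFin//; last 2 first.
- exact: fisher_square_integrable.
- exact: fisher_square_integrable.
rewrite !fisher_square_integral// -EFinB qform_half//.
exact: (Defs.metric_sym g).
Qed.

End fisher_family.

(** * Integration over 1-tuples *)

Section one_tuples.
Variable R : realType.

(** By [lebesgue_tuple_box], the image of the measure on 1-tuples under the only coordinate is
    Lebesgue measure. *)
Lemma ge0_integral_lebesgue_tuple1 (h : measurableTypeR R -> \bar R) :
  measurable_fun setT h -> (forall x, 0 <= h x)%E ->
  (\int[lebesgue_tuple R 1]_(t in setT) h (tnth t ord0) =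
   \int[@lebesgue_measure R]_(x in setT) h x)%E.
Proof.
move=> mh h0; pose phi (t : 1.-tuple (measurableTypeR R)) := tnth t ord0.
have mphi : measurable_fun setT phi by exact: measurable_tnth.
have := @ge0_integral_pushforward _ _ _ _ R _ mphi (lebesgue_tuple R 1) setT h
  measurableT mh (fun x _ => h0 x).
rewrite preimage_setT => <-.
apply: (@eq_measure_integral _ _ _ _ (@lebesgue_measure R)) => A mA _.
have E : (\prod_(i < 1) @lebesgue_measure R A = lebesgue_measure A)%E.
  by rewrite big_ord_recl big_ord0 mule1.
rewrite -[RHS]E -(@lebesgue_tuple_box R 1 (fun=> A))//=.
rewrite /pushforward; congr (lebesgue_tuple_succ _ _).
by apply/seteqP; split => t /= At; [move=> i; rewrite ord1|exact: At].
Qed.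

Lemma integral_lebesgue_tuple1 (h : measurableTypeR R -> \bar R) :
  measurable_fun setT h ->
  (\int[lebesgue_tuple R 1]_(t in setT) h (tnth t ord0) =
   \int[@lebesgue_measure R]_(x in setT) h x)%E.
Proof.
move=> mh; rewrite integralE [RHS]integralE.
rewrite (funepos_comp h (fun t : 1.-tuple (measurableTypeR R) => tnth t ord0)).
rewrite (funeneg_comp h (fun t : 1.-tuple (measurableTypeR R) => tnth t ord0)).
congr (_ - _)%E; apply: ge0_integral_lebesgue_tuple1.
- exact: measurable_funepos.
- by move=> x; exact: funepos_ge0.
- exact: measurable_funeneg.
- by move=> x; exact: funeneg_ge0.
Qed.

End one_tuples.

Theorem corollary4p11 (R : realType) (m : nat) (M : smooth_manifold R m)
    (g : riemannian_metric M) :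
  exists (n : nat) (X : 'I_n -> set R) (P : 'I_n -> R -> M -> R),
    [/\ (0 < n)%N,
        forall i : 'I_n, pdf_family (X i) (P i) &
        forall (c : chart R M m) (p : M),
          local_coordinates c -> chart_dom c p ->
          forall a b : 'I_m,
            fisher_information (disjoint_product_domain X)
              (disjoint_product P) c p a b = (g c p a b)%:E].
Proof.
have [f [f_C1 f_iso]] := isometric_l2 g.
(* One family on the whole line; the disjoint product over one index is the family itself. *)
exists 1%N, (fun=> [set: R]), (fun=> dens f); split => //.
  by move=> _; exact: dens_pdf.
move=> c p lc cp a b; rewrite -(fisher_integral f_C1 f_iso a b lc cp).
rewrite -integral_lebesgue_tuple1; last first.
  by apply/measurable_EFinP; exact: fisher_integrand_measurable.
rewrite /fisher_information.
have -> : disjoint_product_domain (fun _ : 'I_1 => [set: R]) = setT.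
  by apply/seteqP.
apply: eq_integral => t _; rewrite /fisher_integrand.
have dE q : disjoint_product (fun _ : 'I_1 => dens f) t q = dens f (tnth t ord0) q.
  by rewrite /disjoint_product big_ord1.
by rewrite dE !(funext dE).
Qed.
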